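(* Let $Q$ be a network with root $O$ (satisfying the standing assumption in the context) for which the function $f_Q$ is concave. Then the deterministic and randomized expanding competitive ratios satisfy $$\sigma(Q)=\rho(Q)=\deg_Q(O),$$ and the expanding search $S^*$, $S^*(t)=Q[g_Q(t)]$, is an optimal randomized strategy, i.e. $\sup_{H\in Q}\hat T(S^*,H)=\rho(Q)$.
   Context: A network $Q$ is a connected metric graph made of vertices and arcs (possibly unbounded), with a distinguished root vertex $O$, endowed with Lebesgue (length) measure $\lambda$; $\mu=\lambda(Q)\in(0,\infty]$ is its total measure. $d(x)$ is the length of a shortest path from $O$ to $x$. $\deg_Q(v)$ is the degree of $v$ in $Q$, namely the number of arcs incident to $v$. Standing assumption: there is an integer $M$ such that $|\{x\in Q: d(x)=r\}|\le M$ for all $r>0$. For $r\ge 0$, $Q[r]=\{x\in Q: d(x)\le r\}$. Let $r_{\max}=\max_{x\in Q}d(x)$, with $r_{\max}=\infty$ if $Q$ is unbounded. The function $f_Q:[0,r_{\max}]\to\mathbb R$ is $f_Q(r)=\lambda(Q[r])$ (if $r_{\max}=\infty$ read $[0,\infty)$ for $[0,r_{\max}]$); it is strictly increasing, and $g_Q$ denotes its inverse. $S^*$ is defined for $0\le t\le\mu$, $t<\infty$. An expanding search is a family of connected subsets $S(t)\subset Q$, $0\le t\le\mu$ ($t<\infty$), with $S(0)=\{O\}$, $S(t)\subset S(t')$ for $t\le t'$, and $\lambda(S(t))=t$ for all $t$. The search time of $H\in Q$ is $T(S,H)=\min\{t: H\in S(t)\}$; the normalized search time is $\hat T(S,H)=T(S,H)/d(H)$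 for $H\ne O$, and $\hat T(S,O)=0$. The deterministic competitive ratio is $\sigma(Q)=\inf_S\sup_{H\in Q}\hat T(S,H)$ over expanding searches $S$. A randomized search $s$ is a probability distribution over expanding searches; $\hat T(s,H)$ is the expected normalized search time; $\rho(Q)=\inf_s\sup_{H\in Q}\hat T(s,H)$. *)

(* Defs.v *)
From HB Require Import structures.
From mathcomp Require Import all_boot all_order all_algebra.
From mathcomp Require Import all_classical all_reals all_analysis.
Set Implicit Arguments.
Unset Strict Implicit.
Unset Printing Implicit Defensive.
Import Order.TTheory GRing.Theory Num.Theory.
Import numFieldNormedType.Exports.
Local Open Scope classical_set_scope.
Local Open Scope ring_scope.

(* An arc of finite length l is a copy of [0, l], an unbounded one a copy of
   [0, +oo[; coordinate 0 is glued to its tail and, for a finite arc,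
   coordinate l is glued to its head. The orientation only serves as a
   parametrization. Loops and parallel arcs are allowed, and the sets of
   vertices and arcs may be infinite. *)
Record network (R : realType) := Network {
  nvertex : choiceType;
  narc : choiceType;
  narc_len : narc -> \bar R;
  narc_tail : narc -> nvertex;
  narc_head : narc -> option nvertex;
  nroot : nvertex;
  narc_len_gt0 : forall e, (0 < narc_len e)%E;
  narc_head_None : forall e, narc_head e = None <-> narc_len e = +oo%E }.

Section Points.
Context {R : realType} (Q : network R).

Definition is_point (z : nvertex Q + narc Q * R) : bool :=
  match z with
  | inl _ => true
  | inr (e, x) => (0 < x) && (x%:E < narc_len e)%E
  end.

(* A point is a vertex or an interior point of an arc. *)
Definition netpoint := {z : nvertex Q + narc Q * R | is_point z}.

HB.instance Definition _ := Choice.on netpoint.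

Definition origin : netpoint := exist is_point (inl (nroot Q)) isT.

(* p lies on the closed arc e, at coordinate x *)
Definition on_arc (e : narc Q) (x : R) (p : netpoint) : Prop :=
  match val p with
  | inl v => (x = 0 /\ narc_tail e = v) \/
      (x%:E = narc_len e /\ narc_head e = Some v)
  | inr (e', x') => e = e' /\ x = x'
  end.

(* nroute p q a : some path from p to q, made of finitely many segments each
   contained in a closed arc, has length a *)
Inductive nroute : netpoint -> netpoint -> R -> Prop :=
| route_nil p : nroute p p 0
| route_cons p q r e x y a :
    on_arc e x p -> on_arc e y q -> nroute q r a -> nroute p r (`|x - y| + a).

Lemma route_ge0 p q a : nroute p q a -> 0 <= a.
Proof. by elim=> // *; rewrite addr_ge0. Qed.

Lemma route_cat p q r a b : nroute p q a -> nroute q r b -> nroute p r (a + b).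
Proof.
move=> pq; elim: pq r b => [p' r b|p' q' r' e x y c px qy _ IH r b rb].
  by rewrite add0r.
by rewrite -addrA; apply: (route_cons px qy); exact: IH.
Qed.

Lemma route_sym p q a : nroute p q a -> nroute q p a.
Proof.
elim=> [p'|p' q' r' e x y c px qy _ IH]; first exact: route_nil.
rewrite addrC; apply: (route_cat IH).
rewrite distrC -[X in nroute _ _ X]addr0; apply: (route_cons qy px).
exact: route_nil.
Qed.

(* length of a shortest path (a junk value if there is no path at all) *)
Definition distQ (p q : netpoint) : R := inf [set a | nroute p q a].

(* open ball of the path metric *)
Definition path_ball (p : netpoint) (e : R) : set netpoint :=
  [set q | exists2 a, nroute p q a & a < e].

Let ent : set_system (netpoint * netpoint) := entourage_ path_ball.
Let nbhs_point (p : netpoint) : set_system netpoint := nbhs_ ent p.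

Let nbhs_pointE : nbhs_point = nbhs_ ent. Proof. by []. Qed.

HB.instance Definition _ := hasNbhs.Build netpoint nbhs_point.

Let path_ball_center p (e : R) : 0 < e -> path_ball p e p.
Proof. by move=> e0; exists 0 => //; exact: route_nil. Qed.

Let path_ball_sym p q (e : R) : path_ball p e q -> path_ball q e p.
Proof. by case=> a /route_sym ? ?; exists a. Qed.

Let path_ball_triangle p q r e1 e2 :
  path_ball p e1 q -> path_ball q e2 r -> path_ball p (e1 + e2) r.
Proof.
move=> [a pq ae] [b qr be]; exists (a + b); first exact: route_cat pq qr.
exact: ltrD.
Qed.

Let entE : ent = entourage_ path_ball. Proof. by []. Qed.

HB.instance Definition _ := @Nbhs_isPseudoMetric.Build R netpoint
  ent nbhs_pointE path_ball path_ball_center path_ball_sym path_ball_triangle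
  entE.

End Points.

Section Searches.
Context {R : realType} (Q : network R).
Local Open Scope ereal_scope.

(* Lebesgue (length) measure; vertices carry no mass. On non-measurable sets
   this is an outer measure, but connected sets meet each open arc in at most
   two intervals. *)
Definition lambdaQ (A : set (netpoint Q)) : \bar R :=
  \esum_(e in [set: narc Q])
     lebesgue_measure [set x : R | exists2 p, A p & val p = inr (e, x)].

Definition muQ : \bar R := lambdaQ [set: netpoint Q].

Definition dO (x : netpoint Q) : R := distQ (origin Q) x.

(* Number of arc ends at v: a loop at v counts twice. The end (e, false) is the
   tail of e and (e, true) its head. *)
Definition degQ (v : nvertex Q) : \bar R :=
  counting [set h : narc Q * bool |
    if h.2 then narc_head h.1 = Some v else narc_tail h.1 = v].

(* Q[r] *)
Definition closed_disc (r : R) : set (netpoint Q) := [set x | (dO x <= r)%R].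

Definition rmax : \bar R := ereal_sup [set (dO x)%:E | x in [set: netpoint Q]].

(* [0, rmax], read as [0, +oo[ if rmax is infinite *)
Definition radii : set R := [set r | (0 <= r)%R /\ r%:E <= rmax].

Definition fQ (r : R) : R := fine (lambdaQ (closed_disc r)).

(* inverse of fQ on radii *)
Definition gQ : R -> R := 'pinv_(fun=> 0%R) radii fQ.

(* 0 <= t <= mu, t finite *)
Definition times : set R := [set t | (0 <= t)%R /\ t%:E <= muQ].

(* Only the values S t for t in [times] are meaningful. *)
Definition expanding_search (S : R -> set (netpoint Q)) : Prop :=
  [/\ S 0%R = [set origin Q],
      forall t, times t -> connected (S t),
      forall t t', times t -> times t' -> (t <= t')%R -> S t `<=` S t' &
      forall t, times t -> lambdaQ (S t) = t%:E].

(* The first time H is reached, taken as an infimum since an arbitrary search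
   need not attain it; +oo if H is never reached. *)
Definition search_time (S : R -> set (netpoint Q)) (H : netpoint Q) : \bar R :=
  ereal_inf [set t%:E | t in [set t | times t /\ S t H]].

Definition nsearch_time (S : R -> set (netpoint Q)) (H : netpoint Q) : \bar R :=
  if H == origin Q then 0 else search_time S H * ((dO H)^-1)%:E.

Definition sigmaQ : \bar R :=
  ereal_inf [set ereal_sup (range (nsearch_time S)) | S in expanding_search].

(* A distribution over expanding searches, presented as the law of a random
   expanding search defined on some probability space; the events
   "H is in S(t)" generate the sigma-algebra on searches. *)
Record randomized_search := RandomizedSearch {
  rs_disp : measure_display;
  rs_space : measurableType rs_disp;
  rs_prob : probability rs_space R;
  rs_search : rs_space -> R -> set (netpoint Q);
  rs_expanding : forall w, expanding_search (rs_search w);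
  rs_measurable : forall t H, times t ->
    measurable [set w | rs_search w t H] }.

Definition expected_nsearch_time (s : randomized_search) (H : netpoint Q) :
    \bar R :=
  \int[rs_prob s]_w nsearch_time (rs_search w) H.

Definition rhoQ : \bar R :=
  ereal_inf [set y | exists s : randomized_search,
    y = ereal_sup (range (expected_nsearch_time s))].

Definition Sstar (t : R) : set (netpoint Q) := closed_disc (gQ t).

End Searches.

(* Main.v *)
Require Import Defs.
From mathcomp Require Import all_boot all_order all_algebra.
From mathcomp Require Import finmap.
From mathcomp Require Import all_classical all_reals all_analysis.
From mathcomp Require Import measurable_realfun.
From mathcomp Require Import lra zify.
Import Order.TTheory GRing.Theory Num.Theory.
Import numFieldNormedType.Exports.
Local Open Scope classical_set_scope.
Local Open Scope ring_scope.

(** Write d for the distance to the root, n for the degree of the root, and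
    f for fQ, so that f r is the length of the disc of radius r.

    Upper bound. Close to the root the network is a star with n rays, hence
    f r <= n * r for small r (fQ_le_near), and by concavity for all radii
    (fQ_le_degree). The search by discs reaches a point H by the time
    f (d H), so its normalized search time at H is at most n. That it is an
    expanding search requires that f be a bijection from the radii to
    the times, and that discs be connected (disc_connected). The first point follows
    from the coarea principle: the length between two spheres is the integral of
    the number of points per level, and every sphere in between has at least 1 and
    at most M points. Accordingly f has slopes between 1 (lambdaQ_annulus_ge)
    and M (lambdaQ_annulus_le).

    Lower bound. Let the hider choose a point of a small disc around the root
    with density proportional to d. The density cancels the normalization, so
    the average normalized search time is proportional to the average of the
    search time with respect to length. At time t a search has covered the length t only; hence
    the integral of the search time over the disc, of length L = n * r, is at
    least L ^ 2 / 2, whereas the integral of d over the disc is n * r ^ 2 / 2. The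
    quotient is n for every search, hence for every mixture of searches. The
    proof replaces this density by n * m equally spaced points
    (averaged_lower_bound) and lets m tend to infinity; the discrete count
    (probe_count) uses that a connected set containing the root and a point on an
    arc at the root contains the segment in between, unless it is long.

    Since a deterministic search is a randomized one, rhoQ <= sigmaQ, and
    n <= rhoQ <= sigmaQ <= ratio of the search by discs <= n. *)

(** * Finite sets, Lipschitz functions and Lebesgue measure *)

Section generalities.
Set Implicit Arguments.
Unset Strict Implicit.

Lemma common_eps (R : realType) (T : choiceType) (A : set T) (P : T -> R -> Prop) :
  finite_set A ->
  (forall x (d d' : R), P x d -> 0 < d' <= d -> P x d') ->
  (forall x, A x -> exists2 d : R, 0 < d & P x d) ->
  exists2 d : R, 0 < d & forall x, A x -> P x d.
Proof.
move=> /finite_seqP[s ->] Pmono; elim: s => [_|x s IH sP].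
  by exists 1.
have [|d d0 dP] := IH; first by move=> y ys; apply: sP; rewrite /= inE ys orbT.
have [d' d'0 d'P] : exists2 d' : R, 0 < d' & P x d'.
  by apply: sP; rewrite /= inE eqxx.
exists (Num.min d d'); first by rewrite lt_min d0.
move=> y; rewrite /= inE => /orP[/eqP->|ys].
  by apply: Pmono d'P _; rewrite lt_min d0 d'0 ge_min lexx orbT.
by apply: Pmono (dP _ ys) _; rewrite lt_min d0 d'0 ge_min lexx.
Qed.

Lemma card_le_inj_on (T U : choiceType) (f : T -> U) (A : set T) (B : set U) n :
  {in A &, injective f} -> f @` A `<=` B -> (B #<= `I_n)%card ->
  (A #<= `I_n)%card.
Proof.
move=> finj fAB Bn; apply: card_le_trans Bn.
apply: card_le_trans (subset_card_le fAB).
by rewrite (card_le_eql (card_esym (inj_card_eq finj))).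
Qed.

Lemma uniq_size_card (T : choiceType) (t : seq T) (A : set T) n : uniq t ->
  (forall x, x \in t -> A x) -> (A #<= `I_n)%card -> (size t <= n)%N.
Proof.
move=> ut tA An; apply: leq_trans (geq_card_fset_set An).
have finA : finite_set A by apply/finite_set_leP; exists n.
by apply: uniq_leq_size => // x /tA Ax; rewrite in_fset_set// inE.
Qed.

(** The last counted index below m is preceded by all the others. *)
Lemma last_counted (b : nat -> bool) m : (0 < \sum_(i < m) b i)%N ->
  exists2 i, (i < m)%N & b i /\ (\sum_(j < m) b j <= i.+1)%N.
Proof.
elim: m => [|m IH]; first by rewrite big_ord0.
rewrite big_ord_recr /=; case bm: (b m); last first.
  by rewrite addn0 => /IH[i im ib]; exists i => //; exact: ltnW.
move=> _; exists m => //; split => //; rewrite addn1 ltnS.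
rewrite -[leqRHS]card_ord -sum1_card; apply: leq_sum => i _; exact: leq_b1.
Qed.

Lemma sum_succ m : (2 * \sum_(i < m) i.+1 = m * m.+1)%N.
Proof. by elim: m => [|m IH]; rewrite ?big_ord0// big_ord_recr /= mulnDr IH; lia. Qed.

Lemma sum_rev m : (\sum_(i < m) (m - i) = \sum_(i < m) i.+1)%N.
Proof.
rewrite (reindex_inj rev_ord_inj) /=; apply: eq_bigr => i _.
by rewrite subnA// ?subnn//; lia.
Qed.

Lemma lipschitz_continuous_real (R : realType) (f : R -> R) (K : R) :
  (forall x y, f x <= f y + K * `|x - y|) -> continuous f.
Proof.
move=> fl x; apply/cvgrPdist_lt => eps e0.
have K1 : 0 < `|K| + 1 by rewrite ltr_wpDl.
near=> y.
have xy : `|x - y| < eps / (`|K| + 1).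
  by near: y; apply: cvgr_dist_lt; [exact: cvg_id|exact: divr_gt0].
rewrite ltr_pdivlMr// in xy.
have := fl x y; have := fl y x; rewrite (distrC y).
have : K * `|x - y| <= `|x - y| * (`|K| + 1).
  by rewrite mulrC ler_wpM2l//; have := ler_norm K; lra.
by rewrite ltr_norml; lra.
Unshelve. all: by end_near. Qed.

(** The function lebesgue_measure is an outer measure, monotone on all sets: this
    applies to the sets reached by a search, about whose measurability nothing
    is known. *)
Lemma le_lebesgue (R : realType) (A B : set R) : A `<=` B ->
  (lebesgue_measure A <= lebesgue_measure B)%E.
Proof.
rewrite /lebesgue_measure /= /lebesgue_stieltjes_measure /= /measure_extension /=.
by move=> AB; apply: le_mu_ext.
Qed.

Lemma lebesgue_itv_len (R : realType) (a b c d : R) (s1 s2 s3 s4 : bool) :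
  b - a = d - c ->
  lebesgue_measure [set` Interval (BSide s1 a) (BSide s2 b)] =
  lebesgue_measure [set` Interval (BSide s3 c) (BSide s4 d)].
Proof.
move=> abcd; rewrite !lebesgue_measure_itv /= !lte_fin -!EFinB abcd.
by rewrite -subr_gt0 abcd subr_gt0.
Qed.

(** Both integrals are suprema over simple functions. This bounds an expected
    search time from below by the integral of a simple function, before
    anything is known about the measurability of the search time. *)
Lemma le_integral_ge0 d (T : measurableType d) (R : realType)
    (mu : {measure set T -> \bar R}) (f g : T -> \bar R) :
  (forall x, 0 <= f x)%E -> (forall x, f x <= g x)%E ->
  (\int[mu]_x f x <= \int[mu]_x g x)%E.
Proof.
move=> f0 fg; have g0 x : (0 <= g x)%E by apply: le_trans (fg x).
rewrite !ge0_integralTE//; apply: ereal_sup_le => _ [h hf <-].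
by exists h => // x; exact: le_trans (fg x).
Qed.

End generalities.

(** * Distance to the root *)

Section potentials.
Set Implicit Arguments.
Unset Strict Implicit.
Context {R : realType} {Q : network R}.
Implicit Types (phi : nvertex Q -> R) (p q : netpoint Q) (e : narc Q).

(** The real length of a bounded arc; for an unbounded arc it is the junk value 0. *)
Definition alen e : R := fine (narc_len e).

Definition vpoint (v : nvertex Q) : netpoint Q := exist (@is_point R Q) (inl v) isT.

(** The largest 1-Lipschitz function on the arc e whose values at the ends do not
    exceed those of phi. *)
Definition arcval phi e (x : R) : R :=
  if narc_head e is Some h
  then Num.min (phi (narc_tail e) + x) (phi h + alen e - x)
  else phi (narc_tail e) + x.

Definition extend phi p : R :=
  match val p with inl v => phi v | inr (e, x) => arcval phi e x end.

(** The vertex functions that extend to a function 1-Lipschitz on every arc. *)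
Definition potential phi : Prop :=
  forall e h, narc_head e = Some h -> `|phi (narc_tail e) - phi h| <= alen e.

Lemma narc_lenE e h : narc_head e = Some h ->
  narc_len e = (alen e)%:E /\ 0 < alen e.
Proof.
move=> eh; have := narc_len_gt0 e; rewrite /alen.
case le : (narc_len e) => [l| |] //=.
by have := (narc_head_None e).2 le; rewrite eh.
Qed.

Lemma headless_len e : narc_head e = None -> narc_len e = +oo%E.
Proof. by move/narc_head_None. Qed.

Lemma on_arc_tail e : on_arc e 0 (vpoint (narc_tail e)).
Proof. by left. Qed.

Lemma on_arc_head e h : narc_head e = Some h -> on_arc e (alen e) (vpoint h).
Proof. by move=> eh; right; split => //; rewrite (narc_lenE eh).1. Qed.

Lemma on_arc_itv e x p : on_arc e x p -> 0 <= x /\ (x%:E <= narc_len e)%E.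
Proof.
rewrite /on_arc; case: p => -[v|[e' x']] /= pP.
  move=> [[-> _]|[xl _]]; first by split => //; exact/ltW/narc_len_gt0.
  by split; [have := narc_len_gt0 e|]; rewrite -xl// lte_fin => /ltW.
by move: pP => /andP[x0 xl] [-> ->]; split; exact/ltW.
Qed.

Lemma on_arc_ex e x : 0 <= x -> (x%:E <= narc_len e)%E ->
  exists p, on_arc e x p.
Proof.
rewrite le_eqVlt => /predU1P[<- _|x0]; first by exists (vpoint (narc_tail e)); exact: on_arc_tail.
rewrite le_eqVlt => /predU1P[xl|xl]; last first.
  have pP : is_point (inr (e, x) : nvertex Q + narc Q * R) by rewrite /= x0.
  by exists (exist (@is_point R Q) _ pP).
case eh : (narc_head e) => [h|].
  by exists (vpoint h); right.
by move: xl; rewrite (headless_len eh).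
Qed.

Lemma extendE phi e x p : potential phi -> on_arc e x p ->
  extend phi p = arcval phi e x.
Proof.
move=> phiP; rewrite /on_arc /extend; case: p => -[v|[e' x']] /= _; last first.
  by move=> [-> ->].
rewrite /arcval; case=> -[].
  move=> -> <-; case eh: (narc_head e) => [h|]; last by rewrite addr0.
  have := phiP _ _ eh; rewrite addr0 subr0 ler_norml => /andP[_ H].
  by rewrite min_l// -lerBlDl.
move=> xl eh; rewrite eh; have := phiP _ _ eh; rewrite ler_norml => /andP[H _].
move: xl; rewrite (narc_lenE eh).1 => -[->].
by rewrite addrK min_r//; lra.
Qed.

Lemma arcval_lip phi e x y : arcval phi e x <= arcval phi e y + `|x - y|.
Proof.
have xy := ler_norm (x - y); have yx := ler_norm (y - x).
rewrite distrC in yx; rewrite /arcval; case: (narc_head e) => [h|]; last by lra.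
rewrite addr_minl le_min; apply/andP; split; rewrite ge_min; apply/orP.
  by left; lra.
by right; lra.
Qed.

Definition arc_lipschitz (w : netpoint Q -> R) : Prop :=
  forall e x y p q, on_arc e x p -> on_arc e y q -> w p <= w q + `|x - y|.

Lemma extend_lip phi : potential phi -> arc_lipschitz (extend phi).
Proof.
by move=> phiP e x y p q px qy; rewrite (extendE phiP px) (extendE phiP qy) arcval_lip.
Qed.

Lemma route_lip (w : netpoint Q -> R) p q a :
  arc_lipschitz w -> nroute p q a -> w p <= w q + a.
Proof.
move=> wl; elim=> [p'|p' q' r e x y c px qy _ IH]; first by rewrite addr0.
by have := wl _ _ _ _ _ px qy; lra.
Qed.

Lemma route1 e x y p q : on_arc e x p -> on_arc e y q -> nroute p q `|x - y|.
Proof.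
by move=> px qy; rewrite -[X in nroute _ _ X]addr0; apply: (route_cons px qy); exact: route_nil.
Qed.

End potentials.

Section distance.
Set Implicit Arguments.
Unset Strict Implicit.
Context {R : realType} {Q : network R}.
Implicit Types (p q : netpoint Q) (e : narc Q).
Hypothesis Q_connected : connected [set: netpoint Q].

(** The points joined to the root by a route form an open and closed set: a ball
    of radius 1 contains only points joined to its centre. *)
Lemma route_ex p : exists a, nroute (origin Q) p a.
Proof.
pose B := [set q | exists a, nroute (origin Q) q a].
suff BT : B = setT by have : B p by rewrite BT.
have Bball q q' : ball q 1 q' -> B q -> B q'.
  by move=> [a qq' _] [b Oq]; exists (b + a); exact: route_cat Oq qq'.
have Bopen : open B.
  rewrite openE => q Bq; apply/nbhs_ballP; exists 1 => //= q' qq'.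
  exact: Bball qq' Bq.
have Bclosed : closed B.
  rewrite -[B]setCK; apply: open_closedC; rewrite openE => q Bq.
  apply/nbhs_ballP; exists 1 => //= q' qq' Bq'; apply: Bq.
  by apply: Bball Bq'; exact: ball_sym.
apply: Q_connected.
- by exists (origin Q); exists 0; exact: route_nil.
- by exists B => //; rewrite setTI.
- by exists B => //; rewrite setTI.
Qed.

Let routes p : set R := [set a | nroute (origin Q) p a].

Let routes_inf p : has_inf (routes p).
Proof.
split; first exact: route_ex.
by exists 0 => a; exact: route_ge0.
Qed.

Lemma dO_le p a : nroute (origin Q) p a -> dO p <= a.
Proof. by move=> pa; apply: ge_inf => //; exact: (routes_inf p).2. Qed.

Lemma dO_ge0 p : 0 <= dO p.
Proof.
apply: lb_le_inf; first exact: (routes_inf p).1.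
by move=> a; exact: route_ge0.
Qed.

Lemma dO_adherent p (eps : R) : 0 < eps ->
  exists2 a, nroute (origin Q) p a & a < dO p + eps.
Proof. by move=> e0; exact: inf_adherent. Qed.

Lemma dO_origin : dO (origin Q) = 0.
Proof.
by apply/le_anti; rewrite dO_ge0 andbT; apply: dO_le; exact: route_nil.
Qed.

Lemma dO_route p q a : nroute p q a -> dO q <= dO p + a.
Proof.
move=> pq; apply/ler_addgt0Pr => eps e0.
have [b Op bl] := dO_adherent p e0.
by apply: le_trans (dO_le (route_cat Op pq)) _; lra.
Qed.

Lemma dO_lip : arc_lipschitz (@dO R Q).
Proof.
move=> e x y p q px qy; rewrite distrC; exact: (dO_route (route1 qy px)).
Qed.

(** The distance to the root is the largest arc-wise 1-Lipschitz function that
    vanishes at the root. Lower bounds on distances are obtained from suitable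
    potentials through this lemma. *)
Lemma dO_max (w : netpoint Q -> R) : arc_lipschitz w -> w (origin Q) <= 0 ->
  forall p, w p <= dO p.
Proof.
move=> wl w0 p; apply/ler_addgt0Pr => eps e0.
have [a Op al] := dO_adherent p e0.
by have := route_lip wl (route_sym Op); lra.
Qed.

Definition dV (v : nvertex Q) : R := dO (vpoint v).

Lemma dV_potential : potential dV.
Proof.
move=> e h eh; have Ht := dO_lip (on_arc_tail e) (on_arc_head eh).
have Hh := dO_lip (on_arc_head eh) (on_arc_tail e).
rewrite subr0 in Hh; rewrite sub0r normrN in Ht.
rewrite /dV ler_norml; have [_ l0] := narc_lenE eh.
by rewrite (gtr0_norm l0) in Hh Ht; lra.
Qed.

(** A route from the root to a point of an arc ends with a segment from one of the
    two ends of the arc. Formally, the right-hand side is the extension of a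
    potential, hence at most the distance. *)
Lemma dO_arc e x p : on_arc e x p -> dO p = arcval dV e x.
Proof.
move=> px; rewrite -(extendE dV_potential px); apply/le_anti/andP; split.
  rewrite /extend; case: p px => -[v|[e' x']] /= pP px.
    by rewrite le_eqVlt/=; apply/orP; left; apply/eqP; congr dO; exact: val_inj.
  have p'x' : on_arc e' x' (exist (@is_point R Q) (inr (e', x')) pP) by [].
    have /andP[x0 xl] := pP; have := dO_lip p'x' (on_arc_tail e'); rewrite subr0 gtr0_norm//= => Ht.
  rewrite /arcval; case eh: (narc_head e') => [h|] //.
  have := dO_lip p'x' (on_arc_head eh); have [le l0] := narc_lenE eh.
  rewrite le lte_fin in xl; rewrite distrC gtr0_norm ?subr_gt0// => Hh.
  by rewrite le_min Ht/= -addrA.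
apply: dO_max; first exact/extend_lip/dV_potential.
rewrite /extend /= /dV (_ : vpoint _ = origin Q) ?dO_origin//.
Qed.

End distance.

(** * Levels on an arc *)

Section levels.
Set Implicit Arguments.
Unset Strict Implicit.
Context {R : realType} {Q : network R}.
Implicit Types (p q : netpoint Q) (e : narc Q) (h : narc Q * bool).

(** The root stands for the coordinates outside the open arc. *)
Definition arcpoint e (x : R) : netpoint Q :=
  if pselect (is_point (inr (e, x))) is left xP
  then exist (@is_point R Q) _ xP else origin Q.

Lemma val_arcpoint e x : 0 < x -> (x%:E < narc_len e)%E ->
  val (arcpoint e x) = inr (e, x).
Proof.
move=> x0 xl; rewrite /arcpoint; case: pselect => //=.
by rewrite x0.
Qed.

Lemma on_arcpoint e x : 0 < x -> (x%:E < narc_len e)%E ->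
  on_arc e x (arcpoint e x).
Proof. by move=> x0 xl; rewrite /on_arc val_arcpoint. Qed.

Definition end_vertex h : option (nvertex Q) :=
  if h.2 then narc_head h.1 else Some (narc_tail h.1).

Definition along h (y : R) : R := if h.2 then alen h.1 - y else y.

Hypothesis Q_connected : connected [set: netpoint Q].

(** An arc consists of two pieces, one starting at each end, that meet at the point
    of the arc farthest from the root. On the piece of the end h the distance to
    the root grows at unit speed, and h rises through the levels of that
    piece. Counting the ends that rise through s therefore amounts to counting
    points at distance s. *)
Definition rises h (s : R) : Prop :=
  exists2 v, end_vertex h = Some v & dV v < s /\
    forall w, narc_head h.1 = Some w ->
      2 * s < dV (narc_tail h.1) + dV w + alen h.1.

(** The junk value 0 is for the missing head of an unbounded arc. *)
Definition end_level h : R := if end_vertex h is Some v then dV v else 0.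

Definition rise_point h (s : R) := arcpoint h.1 (along h (s - end_level h)).

Lemma rise_pointP h s : rises h s ->
  val (rise_point h s) = inr (h.1, along h (s - end_level h)) /\
  dO (rise_point h s) = s.
Proof.
case: h => e b [v hv []]; rewrite /rise_point /along /end_level hv /=.
move=> vs sP.
suff [x0 xl xd] : [/\ 0 < (if b then alen e - (s - dV v) else s - dV v),
    ((if b then alen e - (s - dV v) else s - dV v)%:E < narc_len e)%E &
    arcval dV e (if b then alen e - (s - dV v) else s - dV v) = s].
  by rewrite val_arcpoint// (dO_arc Q_connected (on_arcpoint x0 xl)).
rewrite /arcval; move: hv; rewrite /end_vertex/=.
case: b => [eh|[tv]]; last subst v.
  have [le l0] := narc_lenE eh; have := sP _ eh.
  have := dV_potential Q_connected eh; rewrite le lte_fin eh ler_norml.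
  move=> /andP[? ?] ?; split; [lra|lra|].
  by rewrite min_r; lra.
case eh: (narc_head e) => [w|].
  have [le l0] := narc_lenE eh; have := sP _ eh.
  have := dV_potential Q_connected eh; rewrite le lte_fin ler_norml.
  move=> /andP[? ?] ?; split; [lra|lra|].
  by rewrite min_l; lra.
rewrite (headless_len eh) ltry; split => //; first by lra.
by rewrite addrC subrK.
Qed.

(** The two ends of one arc rise through s at different points, since the pieces
    are disjoint: this is where the strict inequality in the midpoint condition
    of rises is used. *)
Lemma rise_point_inj s : {in [set h | rises h s] &, injective (rise_point^~ s)}.
Proof.
move=> h h' /[!inE] /= hs h's /(congr1 val).
rewrite (rise_pointP hs).1 (rise_pointP h's).1.
case: h h' hs h's => e b [e' b'] hs h's /=.
move=> [ee']; move: h's; rewrite -ee'; move: hs => [v hv [vs sP]] [v' hv' [v's _]].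
rewrite /along /end_level hv hv' /= in sP *; clear ee'.
move: hv hv'; rewrite /end_vertex /=; case: b; case: b' => // eh eh'.
    by case: eh' => eh'; have := sP _ eh; rewrite -eh' in v's * => ? ?; exfalso; lra.
by case: eh => eh; have := sP _ eh'; rewrite -eh in vs * => ? ?; exfalso; lra.
Qed.

Lemma rises_card (n : nat) s : ([set p : netpoint Q | dO p = s] #<= `I_n)%card ->
  ([set h | rises h s] #<= `I_n)%card.
Proof.
apply: card_le_inj_on; first exact: rise_point_inj.
by move=> _ [h hs <-] /=; exact: (rise_pointP hs).2.
Qed.

End levels.

(** * The neighbourhood of the root, spheres and discs *)

Section root.
Set Implicit Arguments.
Unset Strict Implicit.
Context {R : realType} {Q : network R}.
Implicit Types (p q : netpoint Q) (e : narc Q) (h : narc Q * bool).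
Hypothesis Q_connected : connected [set: netpoint Q].
Variable M : nat.
Hypothesis spheres_bounded : forall r : R, 0 < r ->
  ([set x : netpoint Q | dO x = r] #<= `I_M)%card.

Definition root_ends : set (narc Q * bool) :=
  [set h | end_vertex h = Some (nroot Q)].

Lemma dV_root : dV (nroot Q) = 0.
Proof. exact: (dO_origin Q_connected). Qed.

Lemma dV_ge0 v : 0 <= @dV R Q v.
Proof. exact: dO_ge0. Qed.

Lemma root_rises h s : root_ends h -> 0 < s -> ((2 * s)%:E < narc_len h.1)%E ->
  rises h s.
Proof.
case: h => e b hO s0 sl; exists (nroot Q) => //; rewrite dV_root; split=> //=.
move=> w ew; move: hO sl; rewrite /root_ends/end_vertex/= (narc_lenE ew).1.
rewrite lte_fin; case: b => [|[tO]].
  rewrite ew => -[->]; have := dV_ge0 (narc_tail e).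
  by rewrite dV_root; lra.
by rewrite tO dV_root; have := dV_ge0 w; lra.
Qed.

Lemma arc_len_ge h : exists2 d : R, 0 < d & (d%:E <= narc_len h.1)%E.
Proof.
have := narc_len_gt0 h.1; case: (narc_len h.1) => [l| |] //.
  by rewrite lte_fin => l0; exists l.
by exists 1; rewrite // leey.
Qed.

Lemma short_arcs (A : set (narc Q * bool)) : finite_set A ->
  exists2 d : R, 0 < d & forall h, A h -> (d%:E <= narc_len h.1)%E.
Proof.
move=> finA; apply: (common_eps finA) => [h d d' dl /andP[_ d'd]|h _].
  by apply: le_trans dl; rewrite lee_fin.
exact: arc_len_ge.
Qed.

(** Of M + 1 ends at the root, all would rise through a common small level. *)
Lemma root_ends_finite : finite_set root_ends.
Proof.
apply: contrapT => /(infinite_set_fset M.+1)[B BO].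
have [d d0 dl] := short_arcs (finite_fset B).
apply/negP; rewrite -ltnNge ltnS.
have s0 : 0 < d / 3 by rewrite divr_gt0.
have BM : ([set` B] #<= `I_M)%card.
  apply: card_le_trans (rises_card Q_connected (spheres_bounded s0)).
  apply: subset_card_le => h hB; apply: root_rises => //; first exact: BO.
  by apply: lt_le_trans (dl _ hB); rewrite lte_fin; lra.
by have := geq_card_fset_set BM; rewrite set_fsetK.
Qed.

(** The potential that is 0 at the root and d elsewhere keeps all the other
    vertices at distance d, when d is a common lower bound for the lengths of the
    finitely many arcs at the root. *)
Lemma root_gap : exists2 d : R, 0 < d &
  (forall h, root_ends h -> (d%:E <= narc_len h.1)%E) /\
  (forall v : nvertex Q, v <> nroot Q -> d <= dV v).
Proof.
have [d d0 dl] := short_arcs root_ends_finite.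
exists d => //; split => // v vO.
pose phi (v : nvertex Q) : R := if v == nroot Q then 0 else d.
have phiP : potential phi.
  move=> e w ew; rewrite /phi; have [le l0] := narc_lenE ew.
  have [tO|_] := eqVneq; have [wO|_] := eqVneq;
    rewrite ?subrr ?normr0 ?(ltW l0)//.
    rewrite sub0r normrN gtr0_norm// -lee_fin -le.
    by apply: (dl (e, false)); rewrite /root_ends/end_vertex/= tO.
  rewrite subr0 gtr0_norm// -lee_fin -le.
  by apply: (dl (e, true)); rewrite /root_ends/end_vertex/= ew wO.
have := dO_max Q_connected (extend_lip phiP).
rewrite {1}/extend /= /phi eqxx => /(_ (lexx _) (vpoint v)).
by rewrite /extend /=; case: eqP.
Qed.

(** In an arbitrary network the path metric is only a pseudometric, since
    infinitely many ever shorter arcs may join two vertices. The gap around the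
    root excludes this at the root. *)
Lemma dO_eq0 p : dO p = 0 -> p = origin Q.
Proof.
have [d d0 [_ dv]] := root_gap; case: p => -[v|[e x]] pP pd.
  apply: val_inj => /=; congr inl; apply: contrapT => /dv.
  by rewrite /dV (_ : vpoint v = exist (@is_point R Q) _ pP) ?pd; [lra|exact: val_inj].
exfalso; have /andP[x0 xl] := pP.
have px : on_arc e x (exist (@is_point R Q) (inr (e, x)) pP) by [].
move: pd; rewrite (dO_arc Q_connected px) /arcval.
have := dV_ge0 (narc_tail e); case eh : narc_head => [w|]; last by lra.
rewrite (narc_lenE eh).1 lte_fin in xl.
by have := dV_ge0 w; rewrite minElt; case: ifP => _; lra.
Qed.

Lemma level_finite r : 0 <= r -> finite_set [set p : netpoint Q | dO p = r].
Proof.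
rewrite le_eqVlt => /predU1P[<-|r0].
  apply: (@sub_finite_set _ _ [set origin Q]); last exact: finite_set1.
  by move=> p /dO_eq0 ->.
by apply/finite_set_leP; exists M; exact: spheres_bounded.
Qed.

(** The intermediate value theorem on the arc where the route passes the level s. *)
Lemma route_cross p q c s : nroute p q c -> dO p <= s <= dO q ->
  exists z c1 c2, [/\ nroute p z c1, nroute z q c2, c1 + c2 = c & dO z = s].
Proof.
elim=> [p' /le_anti ps|p' q' r e x y a px qy q'r IH /andP[ps sr]].
  by exists p', 0, 0; split; rewrite ?addr0//; exact: route_nil.
have [sq|qs] := leP s (dO q'); last first.
  have [|z [c1 [c2 [q'z zr c12 zs]]]] := IH; first by rewrite (ltW qs).
  exists z, (`|x - y| + c1), c2; split => //; last by rewrite -addrA c12.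
  exact: route_cons px qy q'z.
have cont : continuous (@arcval R Q dV e).
  by apply: (@lipschitz_continuous_real _ _ 1) => u v; rewrite mul1r arcval_lip.
have ivt (u v : R) : u <= v ->
    Num.min (arcval dV e u) (arcval dV e v) <= s
      <= Num.max (arcval dV e u) (arcval dV e v) ->
    exists2 t, u <= t <= v & arcval dV e t = s.
  move=> uv /(IVT uv); case; first exact: continuous_subspaceT.
  by move=> t; rewrite in_itv /=; exists t.
have dp := dO_arc Q_connected px; have dq := dO_arc Q_connected qy.
have [t [xyt ts t0 tl]] : exists t, [/\ `|x - t| + `|t - y| = `|x - y|,
    arcval dV e t = s, 0 <= t & (t%:E <= narc_len e)%E].
  have [x0 xl] := on_arc_itv px; have [y0 yl] := on_arc_itv qy.
  have [xy|yx] := leP x y.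
    have [|t /andP[xt ty] ts] := ivt _ _ xy.
      by rewrite -dp -dq ge_min le_max ps sq orbT.
    exists t; split=> //; last 2 first.
    - exact: le_trans xt.
    - by apply: le_trans yl; rewrite lee_fin.
    by rewrite !ler0_norm ?subr_le0//; lra.
  have [|t /andP[yt tx] ts] := ivt _ _ (ltW yx).
    by rewrite -dp -dq ge_min le_max ps sq orbT.
  exists t; split=> //; last 2 first.
  - exact: le_trans yt.
  - by apply: le_trans xl; rewrite lee_fin.
  by rewrite !ger0_norm ?subr_ge0//; lra.
have [z zt] := on_arc_ex t0 tl.
exists z, `|x - t|, (`|t - y| + a); split.
- exact: route1 px zt.
- exact: route_cons zt qy q'r.
- by rewrite addrA xyt.
- by rewrite (dO_arc Q_connected zt).
Qed.

(** Routes from the root to x of length close to d x cross the sphere of radius s,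
    which is finite; so one of its points is crossed by routes of length
    arbitrarily close to d x. This stands in for a shortest path to x. *)
Lemma geodesic_point (x : netpoint Q) s : 0 <= s <= dO x ->
  exists2 z : netpoint Q, dO z = s & forall eps : R, 0 < eps ->
    exists2 a, nroute z x a & a < dO x - s + eps.
Proof.
move=> /andP[s0 sx]; apply: contrapT => noz.
have [eps e0 eP] : exists2 eps : R, 0 < eps & forall z : netpoint Q, dO z = s ->
    forall a, nroute z x a -> dO x - s + eps <= a.
  apply: (common_eps (level_finite s0)) => [z d d' H /andP[_ d'd] a za|z zs].
    by have := H _ za; lra.
  apply: contrapT => H; apply: noz; exists z => // eps e0.
  apply: contrapT => nota; apply: H; exists eps => // a za.
  by rewrite leNgt; apply/negP => al; apply: nota; exists a.
have [a Ox al] := dO_adherent Q_connected x e0.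
have [|z [c1 [c2 [Oz zx cE zs]]]] := route_cross (s := s) Ox.
  by rewrite dO_origin ?s0.
have := eP _ zs _ zx; have := dO_le Q_connected Oz; lra.
Qed.

(** Suppose that a relatively open and closed part of the disc is nonempty and
    avoids the root, and let s be the infimum of d on it. If s is attained at b,
    then the points slightly below b on nearly shortest routes to b still belong
    to this part, which contradicts the choice of s. Otherwise the
    finite sphere of radius s lies in the complementary part, and so do all the
    points of the disc that are close to this sphere; but the points of the
    part at a level just above s are close to it. *)
Lemma disc_connected r : 0 <= r -> connected (@closed_disc R Q r).
Proof.
move=> r0; set D := closed_disc r.
have DO : D (origin Q) by rewrite /D/closed_disc/= dO_origin.
have key C C' : open C -> open C' -> D `<=` C `|` C' ->
    D `&` (C `&` C') = set0 -> ~ C (origin Q) -> D `&` C = set0.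
  move=> oC oC' DCC' CC' nCO; apply: contrapT => /eqP/set0P [b0 [Db0 Cb0]].
  pose lev := [set dO b | b in D `&` C].
  have lev_inf : has_inf lev.
    split; first by exists (dO b0), b0.
    by exists 0 => _ [b _ <-]; exact: dO_ge0.
  pose s := inf lev.
  have s_ge0 : 0 <= s.
    apply: lb_le_inf; first exact: lev_inf.1.
    by move=> _ [b _ <-]; exact: dO_ge0.
  have s_le b : D b -> C b -> s <= dO b.
    by move=> Db Cb; apply: ge_inf; [exact: lev_inf.2|exists b].
  have ballP (U : set (netpoint Q)) p : open U -> U p ->
      exists2 eps : R, 0 < eps & forall q a, nroute p q a -> a < eps -> U q.
    rewrite openE => /[apply] /nbhs_ballP[eps /= e0 eU].
    by exists eps => // q a pq ae; apply: eU; exists a.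
  have [[b Db [Cb bs]]|no_min] := pselect (exists2 b, D b & C b /\ dO b = s).
    have s_gt0 : 0 < s.
      rewrite lt_neqAle s_ge0 andbT; apply/eqP => s0; apply: nCO.
      by rewrite -(@dO_eq0 b) // bs.
    have [eps e0 eC] := ballP _ _ oC Cb.
    pose u := Num.max 0 (s - eps / 2).
    have u0 : 0 <= u by rewrite le_max lexx.
    have us : u < s by rewrite gt_max s_gt0/=; lra.
    have us' : s - eps / 2 <= u by rewrite le_max lexx orbT.
    have [|z zu zb] := @geodesic_point b u; first by rewrite u0 bs ltW.
    have [|a za al] := zb (eps / 2); first by rewrite divr_gt0.
    have Cz : C z by apply: eC (route_sym za) _; rewrite bs in al; lra.
    have Dz : D z by move: Db; rewrite /D/closed_disc/= zu bs; lra.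
    by have := s_le _ Dz Cz; rewrite zu; lra.
  have sr : s <= r by apply: le_trans (s_le _ Db0 Cb0) _.
  have [eps e0 eP] : exists2 eps : R, 0 < eps & forall p : netpoint Q, dO p = s ->
      forall q a, nroute p q a -> a < eps -> C' q.
    apply: (common_eps (level_finite s_ge0)) => [p d d' H /andP[_ d'd]|p ps].
      by move=> q a pq ad; apply: H pq _; lra.
    apply: ballP => //; have [] // := DCC' p.
      by rewrite /D/closed_disc/= ps.
    by move=> Cp; case: no_min; exists p => //; rewrite /D/closed_disc/= ps.
  have [|_ [b [Db Cb] <-] bl] := @inf_adherent _ lev (eps / 2) _ lev_inf.
    by rewrite divr_gt0.
  have [|z zs zb] := @geodesic_point b s; first by rewrite s_ge0 s_le.
  have [|a za al] := zb (eps / 2); first by rewrite divr_gt0.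
  suff : (D `&` (C `&` C')) b by rewrite CC'.
  split => //; split => //; apply: (eP _ zs _ _ za).
  by rewrite -/s in bl; lra.
move=> B [b0 Bb0] [C oC BC] [F cF BF].
have oF : open (~` F) by exact: closed_openC.
have [CO|nCO] := pselect (C (origin Q)); last first.
  have B0 : D `&` C = set0.
    apply: (key C (~` F)) => // [x Dx|].
      have [Fx|] := pselect (F x); last by right.
      by left; have : B x by [rewrite BF]; rewrite BC => -[].
    apply/seteqP; split => // x [Dx [Cx nFx]]; apply: nFx.
    by have : B x by [rewrite BC]; rewrite BF => -[].
  by move: Bb0; rewrite BC B0.
have D0 : D `&` ~` F = set0.
  apply: (key (~` F) C) => // [x Dx||/= nFO].
  - have [Fx|] := pselect (F x); last by left.
    by right; have : B x by [rewrite BF]; rewrite BC => -[].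
  - apply/seteqP; split => // x [Dx [nFx Cx]]; apply: nFx.
    by have : B x by [rewrite BC]; rewrite BF => -[].
  - by apply: nFO; have : B (origin Q) by [rewrite BC]; rewrite BF => -[].
rewrite BF; apply/setIidl => x Dx; apply: contrapT => nFx.
by have : (D `&` ~` F) x by []; rewrite D0.
Qed.

End root.

(** * Length between two spheres *)

Section length.
Set Implicit Arguments.
Unset Strict Implicit.
Context {R : realType} {Q : network R}.
Local Notation leb := (@lebesgue_measure R).
Implicit Types (p q : netpoint Q) (e : narc Q) (h : narc Q * bool).
Hypothesis Q_connected : connected [set: netpoint Q].

Definition coords (A : set (netpoint Q)) e : set R :=
  [set x | exists2 p, A p & val p = inr (e, x)].

Lemma lambdaQE A : lambdaQ A = \esum_(e in [set: narc Q]) leb (coords A e).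
Proof. by []. Qed.

Lemma le_lambdaQ A B : A `<=` B -> (@lambdaQ R Q A <= lambdaQ B)%E.
Proof.
move=> AB; apply: le_esum => e _; apply: le_lebesgue => x [p Ap pe].
by exists p => //; exact: AB.
Qed.

Lemma lambdaQ_ge0 A : (0 <= @lambdaQ R Q A)%E.
Proof. by apply: esum_ge0 => e _; exact: measure_ge0. Qed.

Definition annulus (r' r : R) : set (netpoint Q) := [set p | r' < dO p <= r].

Lemma coords_dO (P : set R) e : coords [set p | P (dO p)] e =
  [set x | (0 < x /\ (x%:E < narc_len e)%E) /\ P (arcval dV e x)].
Proof.
apply/seteqP; split=> x /=.
  move=> [[z pP] /= Pp zE]; subst z; have /andP[x0 xl] := pP.
  by split => //; rewrite -(dO_arc Q_connected (p := exist (@is_point R Q) _ pP)).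
move=> [[x0 xl] Px]; exists (arcpoint e x); last exact: val_arcpoint.
by rewrite /= (dO_arc Q_connected (on_arcpoint x0 xl)).
Qed.

Lemma coords_dO_measurable (P : set R) e : measurable P ->
  measurable (coords [set p | P (dO p)] e).
Proof.
move=> mP; rewrite coords_dO.
have -> : [set x | (0 < x /\ (x%:E < narc_len e)%E) /\ P (arcval dV e x)] =
    [set x | 0 < x /\ (x%:E < narc_len e)%E] `&` arcval dV e @^-1` P by [].
apply: measurableI.
  have := narc_len_gt0 e; case: (narc_len e) => [l| |]// _.
    rewrite (_ : [set _ | _] = `]0, l[%classic); last first.
      by apply/seteqP; split=> x /=; rewrite in_itv/= lte_fin => /andP.
    exact: measurable_itv.
  rewrite (_ : [set _ | _] = `]0, +oo[%classic); first exact: measurable_itv.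
  by apply/seteqP; split=> x /=; rewrite in_itv/= ltry andbT; [case|].
have : measurable_fun setT (@arcval R Q dV e).
  apply: continuous_measurable_fun.
  by apply: (@lipschitz_continuous_real _ _ 1) => u v; rewrite mul1r arcval_lip.
by move=> /(_ measurableT P mP); rewrite setTI.
Qed.

Lemma lambdaQ_disc_annulus (r' r : R) : r' <= r ->
  lambdaQ (@closed_disc R Q r) =
  (lambdaQ (@closed_disc R Q r') + lambdaQ (annulus r' r))%E.
Proof.
move=> r'r; rewrite !lambdaQE -esumD; try by move=> *; exact: measure_ge0.
apply: eq_esum => e _.
have m1 : measurable (coords (closed_disc r') e).
  rewrite (_ : closed_disc r' = [set p | [set` `]-oo, r']] (dO p)]); last first.
    by apply/seteqP; split=> p; rewrite /closed_disc /= in_itv.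
  by apply: (@coords_dO_measurable [set` `]-oo, r']] e); exact: measurable_itv.
have m2 : measurable (coords (annulus r' r) e).
  rewrite (_ : annulus r' r = [set p | [set` `]r', r]] (dO p)]); last first.
    by apply/seteqP; split=> p; rewrite /annulus /= in_itv.
  by apply: (@coords_dO_measurable [set` `]r', r]] e); exact: measurable_itv.
rewrite -measureU//.
  congr (leb _); apply/seteqP; split=> x.
    move=> [p pr pe]; have [pr'|pr'] := leP (dO p) r'.
      by left; exists p.
    by right; exists p => //; rewrite /annulus/= pr'.
  move=> [[p pr pe]|[p /andP[_ pr] pe]]; exists p => //.
  by rewrite /closed_disc/=; apply: le_trans r'r.
apply/seteqP; split=> x // [[p pr pe] [q /andP[qr _] qe]].
have pq : p = q by apply: val_inj; rewrite /= pe qe.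
by move: pr; rewrite pq /closed_disc/= leNgt qr.
Qed.

Lemma lambdaQ_vertices A : (forall p, A p -> exists v, val p = inl v) ->
  lambdaQ A = 0%E.
Proof.
move=> Av; rewrite lambdaQE esum1// => e _.
rewrite (_ : coords A e = set0) ?measure0//.
by apply/seteqP; split=> x // [p /Av[v ->]].
Qed.

(** On an unbounded arc the distance rises forever, hence None. *)
Definition peak e : option R :=
  if narc_head e is Some w then Some ((dV (narc_tail e) + dV w + alen e) / 2)
  else None.

Definition band_hi e (r : R) : R :=
  if peak e is Some s then Num.min s r else r.

Definition band_lo h (r' : R) : R := Num.max (end_level h) r'.

(** The levels between r' and r that lie on the piece of the arc starting at h. The
    booleans choose open or closed ends; the junk value is an empty interval. *)
Definition band_side h (s1 s2 : bool) (r' r : R) : interval R :=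
  if end_vertex h is Some _
  then Interval (BSide s1 (band_lo h r')) (BSide s2 (band_hi h.1 r))
  else Interval (BSide false 0) (BSide true 0).

Definition band h := band_side h false true.

Lemma band_rises h (r' r s : R) : s \in band h r' r -> rises h s /\ r' < s < r.
Proof.
rewrite /band /band_side /band_lo /band_hi /peak /rises /end_level.
case hv: (end_vertex h) => [v|]; last by rewrite in_itv/= => /andP[]; lra.
rewrite in_itv /= gt_max => /andP[/andP[vs ->]].
case eh: (narc_head h.1) => [w|]; last first.
  by move=> ->; split => //; exists v.
rewrite lt_min => /andP[sw ->]; split => //; exists v => //; split => // w' [<-].
by lra.
Qed.

(** The part of the arc before its peak is a translate of the band of its tail, the
    part after it a mirror image of the band of its head. *)
Lemma arc_annulus_le (r' r : R) e : (leb (coords (annulus r' r) e) <=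
  leb [set` band (e, false) r' r] + leb [set` band (e, true) r' r])%E.
Proof.
have -> : annulus r' r = [set p | [set s | r' < s <= r] (dO p)] by [].
rewrite coords_dO /=.
rewrite {1}/band /band_side /= /band_lo /band_hi /peak /end_level /=.
set a := dV (narc_tail e).
case eh: (narc_head e) => [w|]; last first.
  rewrite /arcval eh -/a.
  rewrite (@lebesgue_itv_len _ _ _ (Num.max a r' - a) (r - a) _ _ false false);
    last by lra.
  apply: le_trans (leeDl _ (measure_ge0 _ _)); apply: le_lebesgue.
  move=> x /= [[x0 _] /andP[r'x xr]]; rewrite in_itv/=.
  by rewrite ltrBlDr gt_max addrC ltrDl x0 r'x lerBrDl.
rewrite /band /band_side /= /band_lo /band_hi /peak /end_level /end_vertex /= eh.
have [le l0] := narc_lenE eh; rewrite le /arcval eh -/a.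
set b := dV w; set l := alen e; set P := (a + b + l) / 2.
rewrite (@lebesgue_itv_len _ _ _ (Num.max a r' - a) (Num.min P r - a)
  _ _ false false); last by lra.
rewrite (@lebesgue_itv_len _ (Num.max b r') _ (b + l - Num.min P r)
  (b + l - Num.max b r') _ _ true true); last by lra.
apply: (le_trans _ (measureU2 leb (measurable_itv _) (measurable_itv _))).
apply: le_lebesgue => x /= [[x0 xl]]; rewrite lte_fin in xl.
rewrite !in_itv /=; have [xP|xP] := leP (a + x) (b + l - x) => /andP[r'x xr].
  left; rewrite ltrBlDr gt_max lerBrDr le_min (addrC x).
  by rewrite r'x xr ltrDl x0 /P; lra.
right; rewrite lerBlDr -lerBlDl le_min ltrBrDr -ltrBrDl gt_max.
by rewrite r'x xr !andbT /P; apply/andP; split; lra.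
Qed.

Lemma band_le_arc h (r' r : R) :
  (leb [set` band h r' r] <= leb (coords (annulus r' r) h.1))%E.
Proof.
have H s : s \in band h r' r ->
    coords (annulus r' r) h.1 (along h (s - end_level h)).
  move=> /band_rises[hs /andP[r's sr]]; exists (rise_point h s).
    by rewrite /annulus/= (rise_pointP Q_connected hs).2 r's ltW.
  exact: (rise_pointP Q_connected hs).1.
rewrite {1}/band /band_side; case hv: (end_vertex h) => [v|]; last first.
  by rewrite lebesgue_measure_itv /= ltxx.
move: H; rewrite /band/band_side hv /along; set a := end_level h.
case: h.2 => H.
  rewrite (@lebesgue_itv_len _ _ _ (alen h.1 + a - band_hi h.1 r)
    (alen h.1 + a - band_lo h r') _ _ false true); last by lra.
  apply: le_lebesgue => x /=; rewrite in_itv/= => /andP[x1 x2].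
  have := H (alen h.1 + a - x); rewrite (_ : alen h.1 - (alen h.1 + a - x - a) = x); last by lra.
  by apply; rewrite in_itv/=; apply/andP; split; lra.
rewrite (@lebesgue_itv_len _ _ _ (band_lo h r' - a)
    (band_hi h.1 r - a) _ _ false true); last by lra.
apply: le_lebesgue => x /=; rewrite in_itv/= => /andP[x1 x2].
have := H (x + a); rewrite addrK; apply.
by rewrite in_itv/=; apply/andP; split; lra.
Qed.

(** The coarea inequality: by band_rises and arc_annulus_le, the length between two
    spheres is at most the integral over the levels s between them of the number of ends
    that rise through s. *)
Lemma lambdaQ_annulus_le (n : nat) (r' r : R) : r' <= r ->
  (forall s, r' < s < r -> ([set h | @rises R Q h s] #<= `I_n)%card) ->
  (lambdaQ (annulus r' r) <= (n%:R * (r - r'))%:E)%E.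
Proof.
move=> r'r rn; rewrite lambdaQE.
(* It suffices to bound the sum over a finite set of arcs. *)
apply: ge_ereal_sup => _ [X [finX _] <-].
rewrite fsbig_finite//=; set s := fset_set X.
pose hs := [seq (e, b) | e <- s, b <- [:: false; true]].
have uhs : uniq hs.
  by apply: allpairs_uniq => // -[? ?] [? ?].
apply: (@le_trans _ _ (\sum_(h <- hs) leb [set` band h r' r])%E).
  rewrite big_allpairs_dep; apply: lee_sum => e _.
  by rewrite !big_cons big_nil /= adde0; exact: arc_annulus_le.
have indE h : leb [set` band h r' r] =
    (\int[leb]_x (\1_[set` band h r' r] x)%:E)%E.
  by rewrite integral_indic// ?setIT//.
under eq_bigr do rewrite indE.
rewrite -ge0_integral_sum//; last first.
  by move=> h; apply/measurable_EFinP; exact: measurable_indic.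
have -> : (n%:R * (r - r'))%:E = (\int[leb]_(x in `]r', r[) (cst n%:R%:E) x)%E.
  rewrite integral_cst//= EFinM; congr (_ * _)%E.
  rewrite lebesgue_measure_itv/= lte_fin -EFinB; case: ltP => // rr'.
  by have -> : r = r' by [lra]; rewrite subrr.
rewrite [leRHS]integral_mkcond; apply: ge0_le_integral => //=.
- by move=> x _; apply: sume_ge0 => h _; rewrite lee_fin.
- apply: emeasurable_sum => h; apply/measurable_EFinP; exact: measurable_indic.
- apply/(measurable_restrictT _ _).1 => //.
move=> x _; rewrite patchE; case: ifPn => [|] xr.
  rewrite sumEFin lee_fin.
  under eq_bigr do rewrite indicE.
  rewrite -natr_sum ler_nat.
  have -> : (\sum_(h <- hs) (x \in [set` band h r' r]) =
      size [seq h <- hs | x \in band h r' r])%N.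
    by rewrite size_filter -sum1_count [RHS]big_mkcond/=; apply: eq_bigr => h _;
      rewrite mem_setE; case: (_ \in _).
  apply: (uniq_size_card (A := [set h | rises h x])).
  - exact: filter_uniq.
  - by move=> h; rewrite mem_filter => /andP[/band_rises[]].
  - by apply: rn; move: xr; rewrite inE /= in_itv.
rewrite big1// => h _; rewrite indicE memNset//=.
move=> /band_rises[_ xr']; move: xr; rewrite notin_setE /= in_itv/= xr'.
by case.
Qed.

(** The end from which the arc climbs through all the levels that occur on it. *)
Definition low_end e : narc Q * bool :=
  (e, if narc_head e is Some w then dV w < dV (narc_tail e) else false).

Lemma segment_levels e x y p q (r' u s : R) : on_arc e x p -> on_arc e y q ->
  dO p <= s <= dO q -> r' < s < u ->
  s \in band_side (low_end e) true false r' u.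
Proof.
move=> px qy /andP[ps sq] /andP[r's su].
move: ps sq; rewrite (dO_arc Q_connected px) (dO_arc Q_connected qy) /arcval.
rewrite /band_side /band_lo /band_hi /end_level /peak /low_end /end_vertex /=.
have [x0 xl] := on_arc_itv px; have [y0 yl] := on_arc_itv qy.
case eh: (narc_head e) => [w|]; last first.
  move=> ps sq; rewrite in_itv /= ge_max (ltW r's) (ltW su) !andbT; lra.
rewrite (narc_lenE eh).1 !lee_fin in xl yl.
rewrite !minElt => ps sq.
case: ltP => tw; rewrite /= ?eh in_itv /= ge_max le_min (ltW r's) (ltW su) !andbT.
  by move: ps sq; case: ifP => ?; case: ifP => ?; lra.
by move: ps sq; case: ltP => ?; case: ltP => ?; lra.
Qed.

Lemma route_levels p q c (r' u : R) : nroute p q c -> exists es : seq (narc Q),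
  forall s, dO p < s < dO q -> r' < s < u ->
    exists2 e, e \in es & s \in band_side (low_end e) true false r' u.
Proof.
elim=> [p'|p' q' r e x y a px qy _ [es IH]].
  by exists [::] => s /andP[]; lra.
exists (e :: es) => s /andP[ps sr] r'su.
have [sq|qs] := leP s (dO q').
  exists e; first by rewrite inE eqxx.
  by apply: segment_levels px qy _ r'su; rewrite (ltW ps).
have [|e' e'es se'] := IH s _ r'su; first by rewrite qs.
by exists e' => //; rewrite inE e'es orbT.
Qed.

(** A route from the root to a point beyond the level r climbs through all the
    levels between r' and r, so the bands of its finitely many arcs cover this
    interval. *)
Lemma lambdaQ_annulus_ge (r' r : R) : 0 <= r' -> (r%:E <= rmax Q)%E ->
  ((r - r')%:E <= lambdaQ (annulus r' r))%E.
Proof.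
move=> r'0 rmx.
(* Stop below r, since there may be no point at level rmax. *)
apply/lee_addgt0Pr => eps e0; rewrite -leeBlDr// -EFinB.
pose u := r - eps; rewrite (_ : r - r' - eps = u - r'); last by rewrite /u; lra.
have [ur'|r'u] := leP u r'.
  by apply: le_trans (lambdaQ_ge0 _); rewrite lee_fin; lra.
have ur : u <= r by rewrite /u; lra.
have [|_ [x _ <-]] := @ereal_sup_gt _ [set (dO x)%:E | x in [set: netpoint Q]] u%:E.
  by apply: lt_le_trans rmx; rewrite lte_fin /u; lra.
rewrite lte_fin => ux; have [c Ox] := route_ex Q_connected x.
have [es esP] := route_levels r' u Ox.
have -> : (u - r')%:E = leb `]r', u[%classic.
  by rewrite lebesgue_measure_itv/= lte_fin r'u.
rewrite lambdaQE; apply: esum_ge; exists [set` es]; first by split.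
apply: (@le_trans _ _ (\sum_(e \in [set` es])
    leb [set` band_side (low_end e) true false r' u])%E).
  apply: content_sub_fsum => //.
  move=> s /=; rewrite in_itv/= => r'su; have [|e ees se] := esP s _ r'su.
    by rewrite dO_origin//; move: r'su => /andP[? ?]; apply/andP; split; lra.
  by exists e.
apply: lee_fsum => // e _.
apply: (@le_trans _ _ (leb [set` band (low_end e) r' u])).
  rewrite /band /band_side; case: (end_vertex _) => // v.
  by rewrite (@lebesgue_itv_len _ _ _ (band_lo (low_end e) r')
    (band_hi (low_end e).1 u) _ _ false true).
apply: le_trans (band_le_arc _ _ _) _; apply: le_lebesgue => t [p /andP[r'p pu] pe].
by exists p => //; rewrite /annulus /= r'p; apply: le_trans ur.
Qed.

End length.

(** * The search by discs *)

Section discs.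
Set Implicit Arguments.
Unset Strict Implicit.
Context {R : realType} {Q : network R}.
Implicit Types (p q : netpoint Q) (e : narc Q) (h : narc Q * bool).
Hypothesis Q_connected : connected [set: netpoint Q].
Variable M : nat.
Hypothesis spheres_bounded : forall r : R, 0 < r ->
  ([set x : netpoint Q | dO x = r] #<= `I_M)%card.

Lemma annulus_lip (r' r : R) : 0 <= r' -> r' <= r ->
  (lambdaQ (@annulus R Q r' r) <= (M%:R * (r - r'))%:E)%E.
Proof.
move=> r'0 r'r; apply: (lambdaQ_annulus_le Q_connected r'r) => s /andP[r's _].
by apply: (rises_card Q_connected); apply: spheres_bounded; exact: le_lt_trans r's.
Qed.

Lemma disc0 : @closed_disc R Q 0 = [set origin Q].
Proof.
apply/seteqP; split=> p; rewrite /closed_disc/=; last first.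
  by move=> ->; rewrite dO_origin.
move=> p0; apply: (dO_eq0 Q_connected spheres_bounded).
by apply/le_anti; rewrite p0 (dO_ge0 Q_connected).
Qed.

Lemma lambdaQ_disc0 : lambdaQ (@closed_disc R Q 0) = 0%E.
Proof.
by rewrite disc0; apply: lambdaQ_vertices => p ->; exists (nroot Q).
Qed.

Lemma lambdaQ_disc (r : R) : 0 <= r -> lambdaQ (@closed_disc R Q r) = (fQ Q r)%:E.
Proof.
move=> r0; rewrite /fQ fineK// ge0_fin_numE ?lambdaQ_ge0//.
rewrite (lambdaQ_disc_annulus Q_connected r0) lambdaQ_disc0 add0e.
by apply: le_lt_trans (annulus_lip (lexx 0) r0) _; rewrite ltry.
Qed.

Lemma fQ0 : fQ Q 0 = 0.
Proof. by rewrite /fQ lambdaQ_disc0. Qed.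

Lemma lambdaQ_annulus (r' r : R) : 0 <= r' -> r' <= r ->
  lambdaQ (@annulus R Q r' r) = (fQ Q r - fQ Q r')%:E.
Proof.
move=> r'0 r'r; have := lambdaQ_disc_annulus Q_connected r'r.
rewrite !lambdaQ_disc//; last exact: le_trans r'r.
have := annulus_lip r'0 r'r; have := lambdaQ_ge0 (@annulus R Q r' r).
by case: (lambdaQ _) => [x _ _ [->]| |] //; congr EFin; lra.
Qed.

Lemma fQ_lip (r' r : R) : 0 <= r' -> r' <= r ->
  fQ Q r - fQ Q r' <= M%:R * (r - r').
Proof.
by move=> r'0 r'r; rewrite -lee_fin -lambdaQ_annulus//; exact: annulus_lip.
Qed.

Lemma fQ_homo (r' r : R) : 0 <= r' -> r' <= r -> fQ Q r' <= fQ Q r.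
Proof.
move=> r'0 r'r; rewrite -subr_ge0 -lee_fin -lambdaQ_annulus//.
exact: lambdaQ_ge0.
Qed.

Lemma fQ_ge (r' r : R) : 0 <= r' -> r' <= r -> (r%:E <= rmax Q)%E ->
  r - r' <= fQ Q r - fQ Q r'.
Proof.
move=> r'0 r'r rmx; rewrite -lee_fin -lambdaQ_annulus//.
exact: lambdaQ_annulus_ge.
Qed.

Lemma le_rmax p : ((dO p)%:E <= rmax Q)%E.
Proof. by apply: ereal_sup_ubound; exists p. Qed.

Lemma radii_dO p : radii Q (dO p).
Proof. by split; [exact: dO_ge0|exact: le_rmax]. Qed.

Lemma radii_le (r' r : R) : 0 <= r' -> r' <= r -> radii Q r -> radii Q r'.
Proof.
move=> r'0 r'r [_ rmx]; split => //; apply: le_trans rmx; by rewrite lee_fin.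
Qed.

Lemma fQ_lt (r' r : R) : radii Q r' -> radii Q r -> r' < r -> fQ Q r' < fQ Q r.
Proof.
move=> [r'0 _] [_ rmx] r'r; have := fQ_ge r'0 (ltW r'r) rmx; lra.
Qed.

Lemma fQ_inj : {in radii Q &, injective (fQ Q)}.
Proof.
move=> x y /[!inE] rx ry fxy; apply/eqP; rewrite eq_le !leNgt.
by apply/andP; split; apply/negP => /fQ_lt; [move=> /(_ ry rx)|move=> /(_ rx ry)];
  rewrite fxy ltxx.
Qed.

(** The intermediate value theorem for fQ, which is Lipschitz. A radius whose disc
    is large enough is rmax if it is finite, and t itself otherwise, because
    fQ t >= t. *)
Lemma fQ_surj (t : R) : times Q t -> exists2 r, radii Q r & fQ Q r = t.
Proof.
move=> [t0 tmu].
have [r1 r1P tr1] : exists2 r1, radii Q r1 & t <= fQ Q r1.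
  have rm0 : (0 <= rmax Q)%E.
    by have := le_rmax (origin Q); rewrite dO_origin.
  case rE: (rmax Q) rm0 => [r| |] //.
    rewrite lee_fin => r0; exists r; first by split; rewrite ?rE.
    rewrite -lee_fin -lambdaQ_disc//.
    apply: le_trans tmu _; apply: le_lambdaQ => p _.
    by rewrite /closed_disc/= -lee_fin -rE; exact: le_rmax.
  move=> _; exists t; first by split; rewrite // rE leey.
  have := @fQ_ge 0 t; rewrite fQ0 !subr0; apply=> //.
  by rewrite rE leey.
have r10 : 0 <= r1 by case: r1P.
(* The truncation at 0 extends fQ to a function Lipschitz on the whole line. *)
pose g r := fQ Q (Num.max 0 r).
have gc : continuous g.
  apply: (@lipschitz_continuous_real _ _ M%:R) => x y; rewrite /g.
  have M0 : 0 <= M%:R :> R by [].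
  set x' := Num.max 0 x; set y' := Num.max 0 y.
  have x'0 : 0 <= x' by rewrite le_max lexx.
  have y'0 : 0 <= y' by rewrite le_max lexx.
  have [xy|yx] := leP x' y'.
    have := fQ_homo x'0 xy; have := mulr_ge0 M0 (normr_ge0 (x - y)); lra.
  have := fQ_lip y'0 (ltW yx); suff: M%:R * (x' - y') <= M%:R * `|x - y| by lra.
  apply: ler_wpM2l => //; rewrite /x' /y' !maxElt.
  by have := ler_norm (x - y); have := normr_ge0 (x - y); case: ifP; case: ifP; lra.
have [|c] := @IVT _ g 0 r1 t r10 (continuous_subspaceT gc).
  rewrite /g maxxx fQ0 (max_idPr _)// ge_min le_max t0/= tr1 orbT//.
rewrite in_itv/= => /andP[c0 cr1]; rewrite /g (max_idPr _)// => <-.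
by exists c => //; exact: radii_le r1P.
Qed.

Lemma gQ_spec (t : R) : times Q t -> radii Q (gQ Q t) /\ fQ Q (gQ Q t) = t.
Proof.
move=> /fQ_surj[r rr frt]; have gr : gQ Q t = r.
  by rewrite -frt /gQ pinvKV ?inE//; exact: fQ_inj.
by rewrite gr.
Qed.

Lemma times_fQ (r : R) : radii Q r -> times Q (fQ Q r).
Proof.
move=> [r0 _]; split; first by rewrite -fQ0; exact: fQ_homo.
by rewrite -lambdaQ_disc//; exact: le_lambdaQ.
Qed.

Lemma gQ_le (t t' : R) : times Q t -> times Q t' -> t <= t' ->
  gQ Q t <= gQ Q t'.
Proof.
move=> /gQ_spec[rt ft] /gQ_spec[rt' ft'] tt'.
rewrite leNgt; apply/negP => /(fQ_lt rt' rt); lra.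
Qed.

Lemma Sstar_expanding : expanding_search (@Sstar R Q).
Proof.
have t0 : times Q 0 by split => //; exact: lambdaQ_ge0.
split.
- have [g0r g0] := gQ_spec t0; rewrite /Sstar -disc0; congr closed_disc.
  by apply: fQ_inj; rewrite ?inE ?fQ0//; exact: radii_le g0r.1 g0r.
- move=> t /gQ_spec[[g0 _] _]; exact: (disc_connected Q_connected spheres_bounded).
- move=> t t' tt tt' /(gQ_le tt tt') gg p; rewrite /Sstar /closed_disc /= => pt.
  exact: le_trans gg.
- by move=> t /gQ_spec[[g0 _] gt]; rewrite /Sstar lambdaQ_disc// gt.
Qed.

Definition root_degree : nat := #|` fset_set (@root_ends R Q)|.

Lemma degQ_root : degQ (nroot Q) = (root_degree%:R)%:E.
Proof.
rewrite /degQ (_ : [set h | _] = root_ends); last first.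
  apply/seteqP; split=> -[e b]; rewrite /root_ends /end_vertex/=; case: b => //.
    by move=> ->.
  by move=> [].
by rewrite /counting asboolT//; exact: (root_ends_finite Q_connected spheres_bounded).
Qed.

Hypothesis fQ_concave : convex_function (radii Q) (fun r => - fQ Q r).

(** Close to the root only the ends at the root rise, so that the network looks
    like a star there; the coarea inequality applies with their number. *)
Lemma fQ_le_near : exists2 d : R, 0 < d &
  forall r, 0 <= r <= d -> fQ Q r <= root_degree%:R * r.
Proof.
have [d d0 [_ dv]] := root_gap Q_connected spheres_bounded.
exists d => // r /andP[r0 rd].
have := @lambdaQ_annulus 0 r (lexx 0) r0; rewrite fQ0 subr0 -lee_fin => <-.
rewrite -[X in (_ * X)%:E]subr0; apply: (lambdaQ_annulus_le Q_connected r0).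
move=> s /andP[s0 sr]; apply: (@card_le_trans _ _ _ root_ends).
  apply: subset_card_le => h [v hv [vs _]]; rewrite /root_ends /= hv.
  by congr Some; apply: contrapT => /dv; lra.
have finO := root_ends_finite Q_connected spheres_bounded.
have /card_eq_fsetP := erefl root_degree; rewrite fset_setK// => On.
by rewrite (card_le_eql On).
Qed.

(** By concavity the slope fQ r / r of the chord from 0 is nonincreasing in r, and
    it is at most the degree for small r. *)
Lemma fQ_le_degree r : radii Q r -> fQ Q r <= root_degree%:R * r.
Proof.
move=> rr; have r0 := rr.1; have [d d0 dP] := fQ_le_near.
have [rd|dr] := leP r d; first by apply: dP; rewrite r0.
have r_gt0 : 0 < r by exact: lt_trans dr.
have t0 : 0 <= d / r by rewrite divr_ge0 ?ltW.
have t1 : d / r <= 1 by rewrite ler_pdivrMr// mul1r ltW.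
have O0 : radii Q 0 by apply: radii_le rr.
have H : - fQ Q (d / r * r + (1 - d / r) * 0) <=
    d / r * (- fQ Q r) + (1 - d / r) * (- fQ Q 0).
  by apply: (@fQ_concave (Itv01 t0 t1) r 0); rewrite inE.
rewrite fQ0 oppr0 !mulr0 !addr0 divfK ?gt_eqF// in H.
have {H} : d / r * fQ Q r <= root_degree%:R * d.
  by have := dP d; rewrite lexx (ltW d0) => /(_ erefl); lra.
move=> /(ler_wpM2r (ltW r_gt0)); rewrite mulrAC divfK ?gt_eqF// => H.
by rewrite -(ler_pM2l d0) mulrCA mulrA.
Qed.

Lemma Sstar_time p : (search_time (@Sstar R Q) p <= (fQ Q (dO p))%:E)%E.
Proof.
apply: ereal_inf_lbound; exists (fQ Q (dO p)) => //; split.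
  exact/times_fQ/radii_dO.
have [gr gf] := gQ_spec (times_fQ (radii_dO p)).
rewrite /Sstar /closed_disc /= (_ : gQ _ _ = dO p)//.
by apply: fQ_inj; rewrite ?inE//; exact: radii_dO.
Qed.

Lemma dO_gt0 p : p <> origin Q -> 0 < dO p.
Proof.
move=> pO; rewrite lt_neqAle (dO_ge0 Q_connected) andbT.
by apply/eqP => /esym /(dO_eq0 Q_connected spheres_bounded).
Qed.

(** The disc of radius d p contains p and has length at most degree * d p. *)
Lemma Sstar_ratio :
  (ereal_sup (range (nsearch_time (@Sstar R Q))) <= degQ (nroot Q))%E.
Proof.
rewrite degQ_root; apply: ge_ereal_sup => _ [p _ <-]; rewrite /nsearch_time.
case: eqP => [_|pO]; first by rewrite lee_fin.
have p0 := dO_gt0 pO; rewrite lee_pdivrMr//.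
apply: le_trans (Sstar_time p) _; rewrite -EFinM lee_fin.
exact/fQ_le_degree/radii_dO.
Qed.

End discs.

(** * What a connected set must cover *)

Section reaching.
Set Implicit Arguments.
Unset Strict Implicit.
Context {R : realType} {Q : network R}.
Implicit Types (p q : netpoint Q) (e : narc Q) (h : narc Q * bool).
Local Notation leb := (@lebesgue_measure R).

(** A segment that leaves the arc runs through one of its two ends. *)
Lemma route_stays p q a : nroute p q a -> forall e x, val p = inr (e, x) ->
  a < x -> ((x + a)%:E < narc_len e)%E ->
  exists2 y, val q = inr (e, y) & `|x - y| <= a.
Proof.
elim=> [p' e x pe _ _|p' q' r e0 x0 y0 a' px qy rt IH e x pe ax xal].
  by exists x => //; rewrite subrr normr0.
have a'0 := route_ge0 rt.
move: px; rewrite /on_arc pe => -[ee xx]; subst e0 x0.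
move: qy; rewrite /on_arc; case qE: (val q') => [v|[e' y]].
  case=> -[y0E _]; exfalso.
    by move: ax; rewrite y0E subr0; have := ler_norm x; lra.
  move: xal; rewrite -y0E lte_fin; have := ler_norm (y0 - x); rewrite distrC.
  lra.
move=> [ee yy]; move: qE; rewrite -ee -yy => qE.
have xy := ler_norm (x - y0); have yx := ler_norm (y0 - x).
rewrite distrC in yx.
have [||z rE zy] := IH _ _ qE; first by lra.
  by apply: le_lt_trans xal; rewrite lee_fin; lra.
exists z => //; rewrite (_ : x - z = (x - y0) + (y0 - z)); last by lra.
by apply: le_trans (ler_normD _ _) _; lra.
Qed.

(** The open and the closed arc between y and z have the same trace on S, which is
    therefore open and closed in S; it contains x but not the root. *)
Lemma connected_arc (S : set (netpoint Q)) e x y z : connected S ->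
  S (origin Q) -> coords S e x -> y < x < z -> 0 < y ->
  (z%:E < narc_len e)%E -> ~ coords S e y -> ~ coords S e z -> False.
Proof.
move=> cS SO [p0 Sp0 p0E] /andP[yx xz] y0 zl nSy nSz.
pose C : set (netpoint Q) :=
  [set p | exists2 t, val p = inr (e, t) & y < t < z].
pose F : set (netpoint Q) :=
  [set p | exists2 t, val p = inr (e, t) & y <= t <= z].
have oC : open C.
  rewrite openE => p [t pE /andP[yt tz]].
  apply/nbhs_ballP; exists (Num.min (t - y) (z - t)) => /=.
    by rewrite lt_min !subr_gt0 yt tz.
  move=> q [a pq]; rewrite lt_min => /andP[at1 at2].
  have [||t' qE tt'] := route_stays pq pE; first by lra.
    by apply: le_lt_trans zl; rewrite lee_fin; lra.
  exists t' => //; move: tt'; rewrite ler_norml => /andP[? ?].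
  by apply/andP; split; lra.
have [d d0 [dy zd]] : exists2 d : R, 0 < d & d <= y /\ ((z + d)%:E <= narc_len e)%E.
  move: zl; case: (narc_len e) => [l| |] // zl; last first.
    by exists y => //; rewrite leey.
  rewrite lte_fin in zl; exists (Num.min y (l - z)).
    by rewrite lt_min y0 subr_gt0.
  rewrite lee_fin ge_min lexx; split => //.
  by rewrite -lerBrDl ge_min lexx orbT.
have Fstay p q a : F p -> nroute p q a -> a < d ->
    exists t t', [/\ val q = inr (e, t'), y <= t <= z & `|t - t'| <= a].
  move=> [t pE /andP[yt tz]] pq ad.
  have [||t' qE tt'] := route_stays pq pE; first by lra.
    by apply: lt_le_trans zd; rewrite lte_fin; lra.
  by exists t, t'; rewrite yt tz.
have cF : closed F.
  rewrite -[F]setCK; apply: open_closedC; rewrite openE => q nFq.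
  apply/nbhs_ballP.
  have [[t' qE]|nq] := pselect (exists t', val q = inr (e, t')); last first.
    exists d => //= p [a qp ad] Fp; apply: nq.
    by have [t [t' [qE _ _]]] := Fstay _ _ _ Fp (route_sym qp) ad; exists t'.
  have gap : 0 < Num.max (y - t') (t' - z).
    rewrite lt_max !subr_gt0; apply: contrapT => /negP; rewrite negb_or -!leNgt.
    by move=> yz; apply: nFq; exists t'.
  exists (Num.min d (Num.max (y - t') (t' - z))); first by rewrite /= lt_min d0.
  move=> p [a qp]; rewrite lt_min lt_max => /andP[ad at'] Fp.
  have [t [t'' [qE' /andP[yt tz] tt']]] := Fstay _ _ _ Fp (route_sym qp) ad.
  move: qE'; rewrite qE => -[t't'']; rewrite -t't'' in tt'.
  by move: tt' at'; rewrite ler_norml => /andP[? ?] /orP[]; lra.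
have CS : S `&` C = S.
  apply: cS.
  - by exists p0; split => //; exists x => //; rewrite yx.
  - by exists C.
  - exists F => //; apply/seteqP; split=> p [Sp [t pE /andP[yt tz]]]; split=> //.
      by exists t => //; rewrite !ltW.
    exists t => //; rewrite !lt_neqAle yt tz !andbT; apply/andP; split; apply/eqP.
      by move=> yE; apply: nSy; exists p => //; rewrite pE yE.
    by move=> tE; apply: nSz; exists p => //; rewrite pE tE.
by have : (S `&` C) (origin Q); [rewrite CS|move=> [_ []]].
Qed.

Lemma connected_side (S : set (netpoint Q)) e x : connected S ->
  S (origin Q) -> coords S e x ->
  (forall y, 0 < y < x -> coords S e y) \/
  (forall z, x < z -> (z%:E < narc_len e)%E -> coords S e z).
Proof.
move=> cS SO Sx; apply: contrapT => /not_orP[/existsNP[y /not_implyP[/andP[y0 yx] nSy]]].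
move=> /existsNP[z /not_implyP[xz /not_implyP[zl nSz]]].
by apply: (connected_arc cS SO Sx _ y0 zl nSy nSz); rewrite yx.
Qed.

Lemma root_end_head h : root_ends h -> h.2 -> narc_head h.1 = Some (nroot Q).
Proof. by case: h => e []. Qed.

Lemma lambdaQ_ge_arcs (S : set (netpoint Q)) (es : seq (narc Q)) : uniq es ->
  (\sum_(e <- es) leb (coords S e) <= lambdaQ S)%E.
Proof.
move=> ues; rewrite lambdaQE; apply: esum_ge; exists [set` es]; first by split.
by rewrite fsbig_seq.
Qed.

(** Otherwise S would contain the rest of the arc, all the way round from the other
    side, which is longer than S. *)
Lemma reached_segment (S : set (netpoint Q)) h (y r c : R) :
  connected S -> S (origin Q) -> root_ends h -> 0 < y <= r ->
  ((r + c)%:E <= narc_len h.1)%E -> (lambdaQ S < c%:E)%E ->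
  coords S h.1 (along h y) ->
  forall y', 0 < y' < y -> coords S h.1 (along h y').
Proof.
move=> cS SO hO /andP[y0 yr] rcl Sc Sy y' /andP[y'0 y'y].
have no_itv (a b : R) : c <= b - a -> `]a, b[ `<=` coords S h.1 -> False.
  move=> cba H; move: Sc; apply/negP; rewrite -leNgt.
  apply: le_trans (lambdaQ_ge_arcs S (es := [:: h.1]) isT).
  rewrite big_seq1; apply: le_trans (le_lebesgue H).
  rewrite lebesgue_measure_itv/= lte_fin; case: ltP => ab.
    by rewrite -EFinB lee_fin.
  by rewrite lee_fin; lra.
have [Sl|Sr] := connected_side cS SO Sy; move: Sy; rewrite /along;
  case h2: h.2 => Sy.
- exfalso; apply: (no_itv 0 (alen h.1 - y)).
    by move: rcl; rewrite (narc_lenE (root_end_head hO h2)).1 lee_fin; lra.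
  by move=> t /=; rewrite in_itv/= => t01; apply: Sl; rewrite /along h2.
- by apply: Sl; rewrite /along h2 y'0.
- apply: Sr; rewrite /along ?h2; first by lra.
  by rewrite (narc_lenE (root_end_head hO h2)).1 lte_fin; lra.
- exfalso; apply: (no_itv y (r + c)); first by lra.
  move=> t /=; rewrite in_itv/= => /andP[yt trc]; apply: Sr.
    by rewrite /along h2.
  by apply: lt_le_trans rcl; rewrite lte_fin.
Qed.

End reaching.

Section counting_reached.
Set Implicit Arguments.
Unset Strict Implicit.
Context {R : realType} {Q : network R}.
Implicit Types (p q : netpoint Q) (e : narc Q) (h : narc Q * bool).
Local Notation leb := (@lebesgue_measure R).

Variables (n m : nat) (delta : R) (hs : seq (narc Q * bool)).
Hypothesis n_gt0 : (0 < n)%N.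
Hypothesis delta_gt0 : 0 < delta.
Hypothesis hs_uniq : uniq hs.
Hypothesis hs_root : forall h, h \in hs -> root_ends h.
(** The m cells of length delta at one end leave a rest of length at least
    n * m * delta: a set shorter than that cannot arrive the long way round. *)
Hypothesis hs_long : forall h, h \in hs ->
  (((n.+1 * m)%:R * delta)%:E <= narc_len h.1)%E.

Definition probe h (i : nat) : netpoint Q :=
  arcpoint h.1 (along h (i.+1%:R * delta)).

Let reached (S : set (netpoint Q)) h : nat :=
  \sum_(i < m) `[< coords S h.1 (along h (i.+1%:R * delta)) >].

Let reached_le S h : (reached S h <= m)%N.
Proof.
rewrite -[leqRHS]card_ord -sum1_card; apply: leq_sum => i _; exact: leq_b1.
Qed.

(** If c probes of an end are reached, then so is one at distance at least c * delta
    from the root, together with the segment before it. The two segments of a loop at the root do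
    not overlap, by hs_long. *)
Lemma reached_arc S e : connected S -> S (origin Q) ->
  (lambdaQ S < ((n * m)%:R * delta)%:E)%E ->
  ((((if (e, false) \in hs then reached S (e, false) else 0) +
     (if (e, true) \in hs then reached S (e, true) else 0))%:R * delta)%:E
    <= leb (coords S e))%E.
Proof.
move=> cS SO lS.
have seg h : h \in hs -> forall y, 0 < y < (reached S h)%:R * delta ->
    coords S h.1 (along h y).
  move=> hh y /andP[y0 yc].
  have r0 : (0 < reached S h)%N.
    by case: (reached S h) yc => //; rewrite mul0r => /(lt_trans y0); rewrite ltxx.
  have [i im [/asboolP Si ri]] := last_counted
    (b := fun i => `[< coords S h.1 (along h (i.+1%:R * delta)) >]) r0.
  have yi : y < i.+1%:R * delta.
    by apply: lt_le_trans yc _; rewrite ler_pM2r// ler_nat.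
  apply: (reached_segment (r := m%:R * delta)
    (c := (n * m)%:R * delta) cS SO (hs_root hh) _ _ lS Si).
  - by rewrite (lt_trans y0 yi)/= ler_pM2r// ler_nat.
  - by rewrite -mulrDl -natrD -mulSn; exact: hs_long.
  - by rewrite y0.
have rm h : (reached S h)%:R * delta <= m%:R * delta.
  by rewrite ler_pM2r// ler_nat.
have m0 : 0 <= m%:R * delta by rewrite mulr_ge0// ltW.
set c0 := (if (e, false) \in hs then _ else _).
set c1 := (if (e, true) \in hs then _ else _).
have c0P : `]0, (c0%:R * delta)[ `<=` coords S e.
  rewrite /c0; case: ifP => [/seg H|_] t; rewrite /= in_itv/=; first exact: H.
  by rewrite mul0r => /andP[]; lra.
have [h1|h1] := boolP ((e, true) \in hs); last first.
  rewrite /c1 (negbTE h1) addn0; apply: le_trans (le_lebesgue c0P).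
  rewrite lebesgue_measure_itv/= lte_fin; case: ltP => // c0'.
  by rewrite -EFinB subr0.
have /= eO := root_end_head (hs_root h1) isT.
have [le l0] := narc_lenE eO.
have c1m : c1%:R * delta <= m%:R * delta by rewrite /c1 h1; exact: rm.
have c0m : c0%:R * delta <= m%:R * delta.
  by rewrite /c0; case: ifP => _; rewrite ?mul0r//; exact: rm.
have c0_0 : 0 <= c0%:R * delta by rewrite mulr_ge0// ltW.
have c1_0 : 0 <= c1%:R * delta by rewrite mulr_ge0// ltW.
have lm : 2 * (m%:R * delta) <= alen e.
  have := hs_long h1; rewrite /= le lee_fin; apply: le_trans.
  by rewrite mulrA -natrM ler_pM2r// ler_nat leq_mul2r ltnS n_gt0 orbT.
have c1P : `](alen e - c1%:R * delta), (alen e)[ `<=` coords S e.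
  move=> t; rewrite /= in_itv/= => /andP[t1 t2].
  have := seg _ h1 (alen e - t); rewrite /along/= subKr; apply.
  by rewrite subr_gt0 t2/=; move: t1; rewrite /c1 h1; lra.
pose I0 : interval R := `]0, c0%:R * delta[.
pose I1 : interval R := `]alen e - c1%:R * delta, alen e[.
have -> : (((c0 + c1)%:R * delta)%:E = leb [set` I0] + leb [set` I1])%E.
  rewrite !lebesgue_measure_itv/= !lte_fin natrD mulrDl EFinD; congr (_ + _)%E.
    by case: ltP => c; [rewrite -EFinB subr0|congr EFin; lra].
  by case: ltP => c; [rewrite -EFinB; congr EFin; lra|congr EFin; lra].
rewrite -measureU//.
  by apply: le_lebesgue => t [/c0P|/c1P].
apply/seteqP; split=> t //; rewrite /= !in_itv/=; move=> [/andP[_ t0] /andP[t1 _]].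
have := lt_trans t1 t0; rewrite ltNge => /negP; apply.
by rewrite lerBrDr; apply: le_trans lm; rewrite mulr2n mulrDl mul1r lerD.
Qed.

(** Each reached probe accounts for a separate piece of S of length delta. *)
Lemma probe_count S j : connected S -> S (origin Q) ->
  (lambdaQ S <= (j%:R * delta)%:E)%E -> (j < n * m)%N ->
  (\sum_(h <- hs) \sum_(i < m) `[< S (probe h i) >] <= j)%N.
Proof.
move=> cS SO lS jN.
pose es := undup [seq h.1 | h <- hs].
pose c h := if h \in hs then reached S h else 0%N.
have lS' : (lambdaQ S < ((n * m)%:R * delta)%:E)%E.
  by apply: le_lt_trans lS _; rewrite lte_fin ltr_pM2r// ltr_nat.
have sumE : (\sum_(h <- hs) reached S h =
    \sum_(e <- es) (c (e, false) + c (e, true)))%N.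
  transitivity (\sum_(h <- [seq (e, b) | e <- es, b <- [:: false; true]]) c h)%N.
    rewrite /c -[RHS]big_mkcond -[RHS]big_filter; apply: perm_big.
    apply: uniq_perm => //.
      apply: filter_uniq; apply: allpairs_uniq => //; first exact: undup_uniq.
      by move=> [? ?] [? ?].
    move=> [e b]; rewrite mem_filter; have [hh|] := boolP ((e, b) \in hs) => //; rewrite andTb.
    apply/esym/allpairsP; exists (e, b); split=> //=.
      by rewrite mem_undup; apply/mapP; exists (e, b).
    by case: b {hh}; rewrite !inE.
  rewrite big_allpairs_dep; apply: eq_bigr => e _.
  by rewrite !big_cons big_nil /= addn0.
have probeE h i : h \in hs -> (i < m)%N -> S (probe h i) ->
    coords S h.1 (along h (i.+1%:R * delta)).
  move=> hh im Sp; exists (probe h i) => //; apply: val_arcpoint; rewrite /along.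
    case h2: h.2; last by rewrite mulr_gt0.
    have hO := root_end_head (hs_root hh) h2.
    have := hs_long hh; rewrite (narc_lenE hO).1 lee_fin subr_gt0; apply: lt_le_trans.
    by rewrite ltr_pM2r// ltr_nat; nia.
  have pos : 0 < i.+1%:R * delta by rewrite mulr_gt0.
  case h2: h.2.
    have hO := root_end_head (hs_root hh) h2.
    by rewrite (narc_lenE hO).1 lte_fin; lra.
  apply: lt_le_trans (hs_long hh); rewrite lte_fin ltr_pM2r// ltr_nat; nia.
apply: (@leq_trans (\sum_(h <- hs) reached S h)).
  rewrite big_seq [leqRHS]big_seq; apply: leq_sum => h hh; apply: leq_sum => i _.
  case: asboolP => // /(probeE _ _ hh (ltn_ord i)) Si.
  by rewrite (introT (asboolP _) Si).
rewrite sumE -(ler_nat R) -(ler_pM2r delta_gt0) -lee_fin; apply: le_trans lS.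
apply: le_trans (lambdaQ_ge_arcs S (undup_uniq _)).
rewrite natr_sum mulr_suml -sumEFin; apply: lee_sum => e _.
exact: reached_arc.
Qed.

End counting_reached.

(** * Averaging over hiding places *)

Section averaging.
Set Implicit Arguments.
Unset Strict Implicit.

Context {R : realType} {Q : network R}.
Implicit Types (p q : netpoint Q) (e : narc Q) (h : narc Q * bool).
Hypothesis Q_connected : connected [set: netpoint Q].

(** The multiples of delta at which p has not been reached yet all precede the
    search time of p. *)
Lemma search_time_ge (S : R -> set (netpoint Q)) p (K : nat) (delta : R) :
  expanding_search S -> 0 < delta ->
  (forall j : nat, (j < K)%N -> times Q (j.+1%:R * delta)) ->
  (((\sum_(j < K) ~~ `[< S (j.+1%:R * delta)%R p >])%N%:R * delta)%:E
    <= search_time S p)%E.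
Proof.
move=> [_ _ Smono _] d0 dt; apply: le_ereal_inf_tmp => _ [t [tt Stp] <-].
rewrite lee_fin.
apply: (@le_trans _ _ ((\sum_(j < K) (j.+1%:R * delta < t)%R)%N%:R * delta)).
  rewrite ler_pM2r// ler_nat; apply: leq_sum => j _.
  case: asboolP => // nS; case: ltP => // tj; exfalso; apply: nS.
  by apply: Smono tj _ Stp => //; exact: dt.
have t0 : 0 <= t by case: tt.
elim: K {dt} => [|K IH]; first by rewrite big_ord0 mul0r.
rewrite big_ord_recr /=; case: ltP => [Kt|_]; last by rewrite addn0.
apply: le_trans (ltW Kt); rewrite ler_pM2r// ler_nat addn1 ltnS.
rewrite -[leqRHS]card_ord -sum1_card; apply: leq_sum => i _; exact: leq_b1.
Qed.

Lemma muQ_ge e (x : R) : 0 <= x -> (x%:E <= narc_len e)%E -> (x%:E <= muQ Q)%E.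
Proof.
move=> x0 xl; apply: le_trans (lambdaQ_ge_arcs _ (es := [:: e]) isT).
rewrite big_seq1; apply: (@le_trans _ _ (lebesgue_measure `]0, x[%classic)).
  rewrite lebesgue_measure_itv/= lte_fin; case: ltP => //.
    by rewrite -EFinB subr0.
apply: le_lebesgue => t /=; rewrite in_itv/= => /andP[t0 tx].
exists (arcpoint e t) => //; apply: val_arcpoint => //.
by apply: lt_le_trans xl; rewrite lte_fin.
Qed.

Variable M : nat.
Hypothesis spheres_bounded : forall r : R, 0 < r ->
  ([set x : netpoint Q | dO x = r] #<= `I_M)%card.

Lemma nsearch_time_ge0 (S : R -> set (netpoint Q)) p : (0 <= nsearch_time S p)%E.
Proof.
rewrite /nsearch_time; case: eqP => // _; apply: mule_ge0.
  by apply: le_ereal_inf_tmp => _ [t [[t0 _] _] <-].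
by rewrite lee_fin invr_ge0 dO_ge0.
Qed.

Local Notation n := (@root_degree R Q).

(** The hider uses m probes at the distances delta, 2 * delta, ..., m * delta on each
    of the n ends at the root, with weights proportional to these distances. The
    weights cancel the normalization, so that the weighted average of the ratios
    is governed by the sum of the search times of all the N = n * m probes. At
    time j * delta at most j of them have been reached, which makes this sum at least
    delta * N * (N - 1) / 2 for every search, whereas the sum of the distances is
    delta * n * m * (m + 1) / 2. *)
Lemma averaged_lower_bound (s : randomized_search Q) (c : R) (m : nat) :
  (0 < n)%N -> (0 < m)%N ->
  (forall p, expected_nsearch_time s p <= c%:E)%E ->
  (n * m)%:R - 1 <= c * m.+1%:R.
Proof.
move=> n0 m0 sc; have [d d0 [dl _]] := root_gap Q_connected spheres_bounded.
pose N := (n * m)%N; pose K := N.-1.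
have N0 : (0 < N)%N by rewrite muln_gt0 n0.
have NK : N = K.+1 by rewrite prednK.
(* n + 1 would do for probe_count; n + 2 makes the inequalities strict. *)
pose delta := d / (n.+2 * m)%:R.
have nm0 : (0 : R) < (n.+2 * m)%:R by rewrite ltr0n muln_gt0.
have delta0 : 0 < delta by rewrite divr_gt0.
have lt_d k : (k < n.+2 * m)%N -> k%:R * delta < d.
  move=> kn; rewrite /delta mulrCA gtr_pMr// ltr_pdivrMr// mul1r ltr_nat.
  exact: kn.
pose hs : seq (narc Q * bool) := fset_set (@root_ends R Q).
have hs_root h : h \in hs -> root_ends h.
  by rewrite in_fset_set ?inE//; exact: (root_ends_finite Q_connected spheres_bounded).
have hs_long h : h \in hs -> (((n.+1 * m)%:R * delta)%:E <= narc_len h.1)%E.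
  move=> /hs_root/dl; apply: le_trans; rewrite lee_fin ltW// lt_d//.
  by rewrite ltn_pmul2r.
have probe_dO h i : h \in hs -> (i < m)%N ->
    dO (probe delta h i) = i.+1%:R * delta.
  move=> /hs_root hO im; set t := i.+1%:R * delta.
  have ht : rises h t.
    apply: (root_rises Q_connected hO); first by rewrite mulr_gt0.
    apply: lt_le_trans (dl _ hO); rewrite lte_fin mulrA -natrM; apply: lt_d.
    nia.
  have <- := (rise_pointP Q_connected ht).2.
  by rewrite /rise_point /probe /end_level hO (dV_root Q_connected) subr0.
have times_ok j : (j < K)%N -> times Q (j.+1%:R * delta).
  move=> jK; split; first by rewrite mulr_ge0// ltW.
  have : exists h, h \in hs.
    case hsE: hs => [|h l]; last by exists h; rewrite inE eqxx.
    by move: n0; rewrite /root_degree -/hs; move: hsE; rewrite /hs => ->.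
  move=> [h hh]; apply: (@muQ_ge h.1); first by rewrite mulr_ge0// ltW.
  apply: le_trans (dl _ (hs_root _ hh)); rewrite lee_fin ltW// lt_d//.
  by move: jK; rewrite /K /N; nia.
pose late h i j := ~` [set w : rs_space s | rs_search w (j.+1%:R * delta) (probe delta h i)].
(* g h i is a lower bound for the search time of a probe, in units of delta. *)
pose g h i (w : rs_space s) : \bar R := (\sum_(j < K) (\1_(late h i j) w)%:E)%E.
have mlate h i j : (j < K)%N -> measurable (late h i j).
  by move=> jK; apply: measurableC; apply: rs_measurable; exact: times_ok.
have mg h i : measurable_fun setT (g h i).
  apply: emeasurable_sum => j; apply/measurable_EFinP/measurable_indic.
  exact: mlate.
have gE h i w : g h i w = ((\sum_(j < K)
    ~~ `[< rs_search w (j.+1%:R * delta)%R (probe delta h i) >])%N%:R)%:E.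
  rewrite /g sumEFin natr_sum; congr EFin; apply: eq_bigr => j _.
  by rewrite indicE; congr (_ _)%:R; rewrite /late in_setC; congr (~~ _); exact: asbool_equiv_eq.
have g0 h i w : (0 <= g h i w)%E by rewrite gE lee_fin.
have int_g h i : h \in hs -> (i < m)%N ->
    (\int[rs_prob s]_w g h i w <= (i.+1%:R * c)%:E)%E.
  move=> hh im; have i0 : (0 : R) < i.+1%:R by [].
  rewrite EFinM -lee_pdivrMl//; apply: le_trans (sc (probe delta h i)).
  rewrite -ge0_integralZl//.
  apply: le_integral_ge0 => w; first by rewrite mule_ge0// lee_fin invr_ge0.
  rewrite /nsearch_time; case: eqP => [pO|_].
    exfalso; have := probe_dO _ _ hh im; rewrite pO dO_origin// => /esym/eqP.
    by rewrite gt_eqF// mulr_gt0.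
  rewrite probe_dO// lee_pdivlMr; last exact: mulr_gt0.
  apply: le_trans (search_time_ge _ (rs_expanding w) delta0 times_ok).
  rewrite gE -!EFinM lee_fin le_eqVlt; apply/orP; left; apply/eqP.
  by rewrite mulrACA mulVf ?mul1r// gt_eqF.
have swap : (\int[rs_prob s]_w (\sum_(h <- hs) \sum_(i < m) g h i w) =
    \sum_(h <- hs) \sum_(i < m) \int[rs_prob s]_w g h i w)%E.
  rewrite ge0_integral_sum//.
  - by apply: eq_bigr => h _; rewrite ge0_integral_sum.
  - by move=> h; apply: emeasurable_sum => i; exact: mg.
  - by move=> h w _; apply: sume_ge0 => i _; exact: g0.
have late_count (w : rs_space s) : (\sum_(j < K) (N - j.+1) <=
    \sum_(h <- hs) \sum_(i < m) \sum_(j < K)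
      ~~ `[< rs_search w (j.+1%:R * delta)%R (probe delta h i) >])%N.
  rewrite (eq_bigr (fun h => \sum_(j < K) \sum_(i < m)
    ~~ `[< rs_search w (j.+1%:R * delta)%R (probe delta h i) >])%N); last first.
    by move=> h _; rewrite exchange_big.
  rewrite exchange_big /=; apply: leq_sum => j _.
  have [S0 Sconn Smono Slen] := rs_expanding w.
  have tj := times_ok _ (ltn_ord j).
  have SO : rs_search w (j.+1%:R * delta) (origin Q).
    have t0 : times Q 0 by split => //; exact: lambdaQ_ge0.
    by apply: (Smono _ _ t0 tj tj.1); rewrite S0.
  have jN : (j.+1 < n * m)%N by rewrite -/N NK ltnS.
  have := probe_count n0 delta0 (fset_uniq _) hs_root hs_long
    (Sconn _ tj) SO _ jN; rewrite Slen// lexx => /(_ isT).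
  set A := (X in (X <= _)%N -> _) => Aj; set B := leqRHS.
  suff AB : (A + B = N)%N.
    by rewrite -AB leq_subLR leq_add2r.
  rewrite /A /B -big_split /= /N.
  rewrite (eq_bigr (fun=> m)); last first.
    move=> h _; rewrite -big_split /= -[RHS]card_ord -sum1_card.
    by apply: eq_bigr => i _; case: asboolP.
  by rewrite big_const_seq count_predT iter_addn_0 mulnC.
have total : (((\sum_(j < K) (N - j.+1))%N%:R)%:E <=
    \sum_(h <- hs) \sum_(i < m) \int[rs_prob s]_w g h i w)%E.
  rewrite -swap -[leLHS]mule1 -(@probability_setT _ _ _ (rs_prob s)).
  rewrite -integral_cst//; apply: le_integral_ge0 => w; first by rewrite lee_fin.
  have -> : (\sum_(h <- hs) \sum_(i < m) g h i w)%E =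
      ((\sum_(h <- hs) \sum_(i < m) \sum_(j < K)
      ~~ `[< rs_search w (j.+1%:R * delta)%R (probe delta h i) >])%N%:R)%:E.
    rewrite natr_sum -sumEFin; apply: eq_bigr => h _.
    by rewrite natr_sum -sumEFin; apply: eq_bigr => i _; exact: gE.
  by rewrite lee_fin ler_nat.
have : (\sum_(h <- hs) \sum_(i < m) \int[rs_prob s]_w g h i w <=
    (n%:R * ((\sum_(i < m) i.+1)%N%:R * c))%:E)%E.
  apply: (@le_trans _ _ (\sum_(h <- hs) ((\sum_(i < m) i.+1)%N%:R * c)%:E)%E).
    rewrite big_seq [leRHS]big_seq; apply: lee_sum => h hh.
    rewrite natr_sum mulr_suml -sumEFin; apply: lee_sum => i _.
    exact: int_g.
  rewrite sumEFin big_const_seq count_predT iter_addr_0 lee_fin.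
  by rewrite [leRHS]mulr_natl.
move=> /(le_trans total); rewrite lee_fin NK.
rewrite (eq_bigr (fun j : 'I_K => (K - j)%N)); last by move=> j _; rewrite subSS.
rewrite sum_rev => le_sums.
have eK := congr1 (fun x : nat => x%:R : R) (sum_succ K).
have em := congr1 (fun x : nat => x%:R : R) (sum_succ m).
have nmE : (n * m)%:R = K.+1%:R :> R by rewrite -NK.
have K0 : 0 < K.+1%:R :> R by [].
rewrite /= !natrM in eK em; rewrite natrM in nmE; rewrite natrM.
have : K%:R * K.+1%:R <= (c * m.+1%:R) * K.+1%:R by rewrite -nmE; nra.
by rewrite ler_pM2r// nmE -natr1; lra.
Qed.

(** For a finite ratio c, averaged_lower_bound reads n * m - 1 <= c * (m + 1); let m
    tend to infinity. *)
Lemma expected_ge_degree (s : randomized_search Q) :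
  (degQ (nroot Q) <= ereal_sup (range (expected_nsearch_time s)))%E.
Proof.
rewrite (degQ_root Q_connected spheres_bounded).
set C := ereal_sup _.
have sC p : (expected_nsearch_time s p <= C)%E.
  by apply: ereal_sup_ubound; exists p.
have C0 : (0 <= C)%E.
  apply: le_trans (sC (origin Q)); apply: integral_ge0 => w _.
  exact: nsearch_time_ge0.
case CE: C sC C0 => [c| |] // sC c0; last by rewrite leey.
rewrite lee_fin in c0; rewrite lee_fin.
have [->//|n0] := posnP n.
rewrite leNgt; apply/negP => cn.
have nc : 0 < n%:R - c by rewrite subr_gt0.
pose m := (Num.truncn ((c + 1) / (n%:R - c))).+1.
have := averaged_lower_bound n0 (ltn0Sn _ : (0 < m)%N) sC.
have : (c + 1) / (n%:R - c) < m%:R by exact: truncnS_gt.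
rewrite ltr_pdivrMr// natrM -[m.+1%:R]natr1; lra.
Qed.

(** A deterministic search is a random search on a one-point probability space. *)
Lemma rhoQ_le (S : R -> set (netpoint Q)) : expanding_search S ->
  (rhoQ Q <= ereal_sup (range (nsearch_time S)))%E.
Proof.
move=> ES.
have mS t (H : netpoint Q) : times Q t -> measurable [set w : unit | S t H].
  move=> _; have [SH|nSH] := pselect (S t H).
    by rewrite (_ : [set _ | _] = setT)//; apply/seteqP; split.
  by rewrite (_ : [set _ | _] = set0)//; apply/seteqP; split.
pose s := @RandomizedSearch R Q _ unit (dirac tt : probability unit R)
  (fun=> S) (fun=> ES) mS.
apply: ereal_inf_lbound; exists s; congr ereal_sup; apply/seteqP.
have sE H : expected_nsearch_time s H = nsearch_time S H.
  transitivity (\int[rs_prob s]_w cst (nsearch_time S H) w)%E; first by [].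
  rewrite integral_cst//; apply: etrans (mule1 _); congr (_ * _)%E.
  exact: diracT.
by split=> _ [H _ <-]; exists H.
Qed.

End averaging.

Theorem corollary11 (R : realType) (Q : network R)
  (Q_connected : connected [set: netpoint Q])
  (mu_gt0 : (0 < muQ Q)%E)
  (spheres_bounded : exists M : nat, forall r : R, 0 < r ->
     ([set x : netpoint Q | dO x = r] #<= `I_M)%card)
  (fQ_concave : convex_function (radii Q) (fun r => - fQ Q r)) :
  [/\ sigmaQ Q = degQ (nroot Q),
      rhoQ Q = degQ (nroot Q),
      expanding_search (@Sstar R Q) &
      ereal_sup (range (nsearch_time (@Sstar R Q))) = rhoQ Q].
Proof.
case: spheres_bounded => M HM.
have ES := Sstar_expanding Q_connected HM.
have upper := Sstar_ratio Q_connected HM fQ_concave.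
have lower : (degQ (nroot Q) <= rhoQ Q)%E.
  by apply: le_ereal_inf_tmp => _ [s ->]; exact: (expected_ge_degree Q_connected HM).
have rho_sigma : (rhoQ Q <= sigmaQ Q)%E.
  by apply: le_ereal_inf_tmp => _ [S ES' <-]; exact: rhoQ_le.
have sigma_star : (sigmaQ Q <= ereal_sup (range (nsearch_time (@Sstar R Q))))%E.
  by apply: ereal_inf_lbound; exists (@Sstar R Q).
have rhoE : rhoQ Q = degQ (nroot Q).
  apply/le_anti; rewrite lower andbT.
  exact: le_trans rho_sigma (le_trans sigma_star upper).
split => //.
  apply/le_anti; rewrite (le_trans sigma_star upper)/=.
  exact: le_trans rho_sigma.
by apply/le_anti; rewrite rhoE upper /= -rhoE (le_trans rho_sigma).
Qed.
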